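(* Let $\Gamma$ be a discrete amenable group and let $\alpha$ be an action of $\Gamma$ on a compact Hausdorff space $X$ by homeomorphisms. Let $\vartheta$ be a continuous pseudometric on $X$. Let $\{F_n\}_{n\in J}$ be a left Følner net of $\Gamma$. For any $1\le p\le\infty$, we have $$\sup_{\mathcal{U}}\mathrm{h}_{\rm top}(\alpha,\mathcal{U})=\lim_{\varepsilon\to0}\limsup_{n\to\infty}\frac{1}{|F_n|}\log s_{\vartheta,F_n,p}(\varepsilon)=\lim_{\varepsilon\to0}\liminf_{n\to\infty}\frac{1}{|F_n|}\log s_{\vartheta,F_n,p}(\varepsilon)$$ $$=\lim_{\varepsilon\to0}\limsup_{n\to\infty}\frac{1}{|F_n|}\log r_{\vartheta,F_n,p}(\varepsilon)=\lim_{\varepsilon\to0}\liminf_{n\to\infty}\frac{1}{|F_n|}\log r_{\vartheta,F_n,p}(\varepsilon),$$ where $\mathcal{U}$ runs through all finite open covers of $X$ generated by $\vartheta$ under $\alpha$. In particular, if the topology of $X$ is generated by $\vartheta$ under $\alpha$, then $$\mathrm{h}_{\rm top}(\alpha)=\lim_{\varepsilon\to0}\limsup_{n\to\infty}\frac{1}{|F_n|}\log s_{\vartheta,F_n,p}(\varepsilon)=\lim_{\varepsilon\to0}\liminf_{n\to\infty}\frac{1}{|F_n|}\log s_{\vartheta,F_n,p}(\varepsilon)$$ $$=\lim_{\varepsilon\to0}\limsup_{n\to\infty}\frac{1}{|F_n|}\log r_{\vartheta,F_n,p}(\varepsilon)=\lim_{\varepsilon\to0}\liminf_{n\to\infty}\frac{1}{|F_n|}\log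 r_{\vartheta,F_n,p}(\varepsilon).$$
   Context: A left Følner net of $\Gamma$ is a net $\{F_n\}_{n\in J}$ of nonempty finite subsets of $\Gamma$ with $\lim_n |KF_n\Delta F_n|/|F_n|=0$ for every finite $K\subseteq\Gamma$. For a finite open cover $\mathcal{U}$ of $X$, $N(\mathcal{U})$ is the minimal number of elements of $\mathcal{U}$ needed to cover $X$, $\mathcal{U}^F=\bigvee_{\gamma\in F}\gamma^{-1}\mathcal{U}$ for nonempty finite $F\subseteq\Gamma$, and $\mathrm{h}_{\rm top}(\alpha,\mathcal{U})=\lim_n\frac{1}{|F_n|}\log N(\mathcal{U}^{F_n})$ (the limit exists and does not depend on the left Følner net); the topological entropy $\mathrm{h}_{\rm top}(\alpha)$ is the supremum of $\mathrm{h}_{\rm top}(\alpha,\mathcal{U})$ over all finite open covers of $X$. A continuous pseudometric on $X$ is a symmetric continuous map $\vartheta:X\times X\to[0,\infty)$ vanishing on the diagonal and satisfying the triangle inequality. For nonempty finite $F\subseteq\Gamma$, $1\le p\le\infty$ and $x,y\in X$, $d_{\vartheta,F,p}(x,y)$ is the $\ell^p$-norm of the function $\gamma\mapsto\vartheta(\gamma x,\gamma y)$ on $F$ divided by $|F|^{1/p}$ (for $p=\infty$ it is $\max_{\gamma\in F}\vartheta(\gamma x,\gamma y)$). A set $E\subseteq X$ is $[\vartheta,F,p,\varepsilon]$-separated if $d_{\vartheta,F,p}(x,y)>\varepsilon$ for all $x\ne y$ in $E$, and $[\vartheta,F,p,\varepsilon]$-spanning if for every $x\in X$ there is $y\in E$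 with $d_{\vartheta,F,p}(x,y)\le\varepsilon$. $s_{\vartheta,F,p}(\varepsilon)$ is the maximal cardinality of a $[\vartheta,F,p,\varepsilon]$-separated subset of $X$ and $r_{\vartheta,F,p}(\varepsilon)$ the minimal cardinality of a $[\vartheta,F,p,\varepsilon]$-spanning subset of $X$. An open subset $U$ of $X$ is generated by $\vartheta$ under $\alpha$ if it belongs to the weakest topology on $X$ making all the pseudometrics $(x,y)\mapsto\vartheta(\gamma x,\gamma y)$, $\gamma\in\Gamma$, continuous; equivalently, $U$ is a union of sets each of which is, for some nonempty finite $F\subseteq\Gamma$, a union of open balls of positive radius for the pseudometric $\vartheta^F(x,y)=\max_{\gamma\in F}\vartheta(\gamma x,\gamma y)$. A finite open cover is generated by $\vartheta$ under $\alpha$ if each of its members is. The topology of $X$ is generated by $\vartheta$ under $\alpha$ if it equals that weakest topology; equivalently, $x=y$ whenever $\vartheta(\gamma x,\gamma y)=0$ for all $\gamma\in\Gamma$. *)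

(* Defs.v *)
From HB Require Import structures.
From mathcomp Require Import all_boot all_order all_algebra finmap.
From mathcomp Require Import all_classical all_reals all_analysis.

Set Implicit Arguments.
Unset Strict Implicit.
Unset Printing Implicit Defensive.

Import Order.TTheory GRing.Theory Num.Theory.
Import numFieldNormedType.Exports.

Local Open Scope classical_set_scope.
Local Open Scope ring_scope.

Definition finitely_additive_prob (R : realType) (T : Type)
    (m : set T -> R) : Prop :=
  [/\ forall A, 0 <= m A, m setT = 1 &
      forall A B, A `&` B = set0 -> m (A `|` B) = m A + m B].

Definition amenable (R : realType) (Gamma : groupType) : Prop :=
  exists m : set Gamma -> R, finitely_additive_prob m /\
    forall (g : Gamma) (A : set Gamma), m [set (g * h)%g | h in A] = m A.

Definition is_homeo (X Y : topologicalType) (f : X -> Y) : Prop :=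
  continuous f /\
  exists h : Y -> X, [/\ cancel f h, cancel h f & continuous h].

Definition action_by_homeos (Gamma : groupType) (X : topologicalType)
    (alpha : Gamma -> X -> X) : Prop :=
  [/\ forall x, alpha 1%g x = x,
      forall g h x, alpha (g * h)%g x = alpha g (alpha h x) &
      forall g, is_homeo (alpha g)].

Definition directed (d : Order.disp_t) (J : preorderType d) : Prop :=
  [set: J] !=set0 /\ forall i j : J, exists k : J, (i <= k)%O /\ (j <= k)%O.

Definition net_filter (d : Order.disp_t) (J : preorderType d) : set_system J :=
  filter_from [set: J] (fun j => [set k | (j <= k)%O]).
Arguments net_filter {d} J.

(* [limf_esup] requires a filteredType as index type, which a directed set is
   not. *)
Definition net_limsup (R : realType) (d : Order.disp_t) (J : preorderType d)
    (u : J -> \bar R) : \bar R :=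
  ereal_inf [set ereal_sup [set u k | k in [set k | (j <= k)%O]] | j in setT].

Definition net_liminf (R : realType) (d : Order.disp_t) (J : preorderType d)
    (u : J -> \bar R) : \bar R :=
  ereal_sup [set ereal_inf [set u k | k in [set k | (j <= k)%O]] | j in setT].

Definition fset_symdiff (T : choiceType) (A B : {fset T}) : {fset T} :=
  ((A `\` B) `|` (B `\` A))%fset.

Definition fset_prod (Gamma : groupType) (K F : {fset Gamma}) : {fset Gamma} :=
  [fset (k * f)%g | k in K, f in F]%fset.

(* K must be nonempty: for K = fset0 the quotient below is constantly 1. *)
Definition left_Folner_net (R : realType) (Gamma : groupType)
    (d : Order.disp_t) (J : preorderType d) (F : J -> {fset Gamma}) : Prop :=
  [/\ directed J, forall n, F n != fset0 &
      forall K : {fset Gamma}, K != fset0 ->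
        (#|` fset_symdiff (fset_prod K (F n)) (F n)|%:R / #|` F n|%:R : R)
          @[n --> net_filter J] --> (0 : R)].

Section FixAction.
Context (R : realType) (Gamma : groupType) (X : topologicalType).
Variable alpha : Gamma -> X -> X.
Implicit Types (F : {fset Gamma}) (U V : set (set X)).

Definition set_cover (T : Type) (U : set (set T)) : Prop :=
  \bigcup_(A in U) A = setT.

Definition finite_open_cover U : Prop :=
  [/\ finite_set U, forall A, U A -> open A & set_cover U].

Definition cover_number (U : set (set X)) : \bar R :=
  ereal_inf [set (#|` V|%:R)%:E | V in
    [set V : {fset (set X)} | [set` V] `<=` U /\ set_cover [set` V]]].

Definition cover_join (U : set (set X)) (F : {fset Gamma}) : set (set X) :=
  [set \bigcap_(g in [set` F]) (alpha g @^-1` u g) | u in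
    [set u : Gamma -> set X | forall g, g \in F -> U (u g)]].

Definition normalized_log F (c : \bar R) : \bar R :=
  ((#|` F|%:R^-1 : R)%:E * lne c)%E.

(* The common limit along all left Folner nets. *)
Definition htop_cover (U : set (set X)) : \bar R :=
  xget 0%E [set h : \bar R |
    forall (d : Order.disp_t) (J : preorderType d) (F : J -> {fset Gamma}),
      left_Folner_net R F ->
      normalized_log (F n) (cover_number (cover_join U (F n)))
        @[n --> net_filter J] --> h].

Definition htop : \bar R :=
  ereal_sup [set htop_cover U | U in finite_open_cover].

Variable theta : X -> X -> R.

Definition continuous_pseudometric : Prop :=
  [/\ forall x y, 0 <= theta x y, forall x, theta x x = 0,
      forall x y, theta x y = theta y x,
      forall x y z, theta x z <= theta x y + theta y z &
      continuous (fun z : X * X => theta z.1 z.2)].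

(* The last branch is the case p = +oo; -oo is excluded by 1 <= p. *)
Definition dist_lp F (p : \bar R) (x y : X) : R :=
  match p with
  | r%:E => (\sum_(g <- F) theta (alpha g x) (alpha g y) `^ r) `^ r^-1
              / (#|` F|%:R `^ r^-1)
  | _ => \big[Num.max/0]_(g <- F) theta (alpha g x) (alpha g y)
  end.

Definition separated_set F p (e : R) (E : set X) : Prop :=
  forall x y, E x -> E y -> x <> y -> e < dist_lp F p x y.

Definition spanning_set F p (e : R) (E : set X) : Prop :=
  forall x, exists2 y, E y & dist_lp F p x y <= e.

(* Finite subsets suffice: subsets of a separated set are separated, so an
   infinite separated set makes the supremum +oo; similarly the infimum over
   the empty set is +oo. *)
Definition sep_number F p (e : R) : \bar R :=
  ereal_sup [set (#|` E|%:R)%:E | E in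
    [set E : {fset X} | separated_set F p e [set` E]]].

Definition span_number F p (e : R) : \bar R :=
  ereal_inf [set (#|` E|%:R)%:E | E in
    [set E : {fset X} | spanning_set F p e [set` E]]].

(* The weakest topology making the pseudometrics continuous is the
   intersection of all topologies on the carrier X that make them continuous
   on the corresponding product. *)
Definition generated_set (A : set X) : Prop :=
  forall T : Topological X, let XT := Topological.Pack T in
    (forall g : Gamma, continuous (fun z : XT * XT =>
       theta (alpha g (z.1 : X)) (alpha g (z.2 : X)))) ->
    @open XT A.

Definition generated_cover U : Prop := forall A, U A -> generated_set A.

Definition topology_generated : Prop :=
  forall A : set X, open A <-> generated_set A.

End FixAction.

Arguments cover_number R {X} U.
Arguments htop_cover R {Gamma X} alpha U.
Arguments htop R {Gamma X} alpha.

(* Main.v *)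
From HB Require Import structures.
Require Import Defs.
From mathcomp Require Import all_boot all_order all_algebra finmap.
From mathcomp Require Import all_classical all_reals all_analysis.
From mathcomp Require Import ring lra.
Import Order.TTheory GRing.Theory Num.Theory.
Import numFieldNormedType.Exports.
Local Open Scope classical_set_scope.
Local Open Scope ring_scope.

Set Implicit Arguments.
Unset Strict Implicit.
Unset Printing Implicit Defensive.

(** The limit defining the entropy of a cover is an instance of the
    Ornstein-Weiss lemma for the subadditive function
    [phi A = log N(U^A)]. Given tiles [D] on which [phi D / |D|] is close to the
    lower limit, a very invariant set [Om] is covered greedily: one adds right
    translates of a tile as long as they overlap the part already covered in a
    small proportion, and starts again with a less invariant tile. As the part
    already covered is much more invariant than the next tile, each round
    covers a fixed proportion of what remains, and the number of translates is
    controlled by the size of their union, whence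
    [phi Om / |Om|] is bounded by the lower limit up to a small error.

    For the theorem, a cover by [theta]-balls of radius [e/2] bounds separated
    sets from above. Conversely let [K] and [del] be a Lebesgue number of a
    generated cover [U]. By Markov's inequality, if [d_{theta,F,p}(x,y)] is
    small then [theta(kgx,kgy) < del] for all [k] in [K], except for a small
    proportion of the [g] in [F]; so a spanning set together with the choice of
    the members of [U] at the few exceptional places yields a subcover of
    [U^F], and the number of these choices is exponentially small. *)

(** * The Ornstein-Weiss lemma *)

Section Tiles.
Context (G : groupType).
Implicit Types (A B D I K L P S : {fset G}) (g h : G).

Lemma fset_prodP K S g :
  reflect (exists k s, [/\ k \in K, s \in S & g = (k * s)%g])
          (g \in fset_prod K S).
Proof.
apply: (iffP (imfset2P _ _ _ _ _)) => [[k kK [s sS ->]]|[k [s [kK sS ->]]]].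
  by exists k, s.
by exists k => //; exists s.
Qed.

Lemma mem_fset_prod K S k s :
  k \in K -> s \in S -> (k * s)%g \in fset_prod K S.
Proof. by move=> kK sS; apply/fset_prodP; exists k, s. Qed.

Lemma fset_prodUr K S P :
  fset_prod K (S `|` P)%fset = (fset_prod K S `|` fset_prod K P)%fset.
Proof.
apply/fsetP => g; rewrite in_fsetU; apply/fset_prodP/orP.
  move=> [k [s [kK]]]; rewrite in_fsetU => /orP[sS|sP] ->.
    by left; exact: mem_fset_prod.
  by right; exact: mem_fset_prod.
by case=> /fset_prodP[k [s [kK sS ->]]]; exists k, s;
  rewrite in_fsetU sS ?orbT.
Qed.

Lemma card_fset_prod K S : (#|` fset_prod K S| <= #|` K| * #|` S|)%N.
Proof.
rewrite -(size_allpairs (fun k s => (k * s)%g)).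
apply: uniq_leq_size; first exact: fset_uniq.
move=> g /fset_prodP[k [s [kK sS ->]]]; apply/allpairsP.
by exists (k, s).
Qed.

Lemma fset_prod0r K : fset_prod K fset0 = fset0.
Proof.
by apply/eqP; rewrite -cardfs_eq0 -leqn0 (leq_trans (card_fset_prod _ _))//
  cardfs0 muln0.
Qed.

(** Counting the [d] instead of the points of the intersection gives a sum that can be exchanged
    with a sum over [g]. *)
Definition overlap D S g : nat := \sum_(d <- D) ((d * g)%g \in S).

Lemma card_fset_prod1 D g : #|` fset_prod D [fset g]%fset| = #|` D|.
Proof.
have -> : fset_prod D [fset g]%fset = [fset (d * g)%g | d in D]%fset.
  apply/fsetP => x; apply/fset_prodP/imfsetP => /=.
    by move=> [d [s [dD]]]; rewrite in_fset1 => /eqP -> ->; exists d.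
  by move=> [d dD ->]; exists d, g; rewrite in_fset1.
by rewrite card_imfset//; exact: mulIg.
Qed.

Lemma overlapE D S g :
  overlap D S g = #|` fset_prod D [fset g] `&` S|%fset.
Proof.
rewrite /overlap.
have -> : (fset_prod D [fset g] `&` S =
    [fset (d * g)%g | d in [fset d in D | (d * g)%g \in S]])%fset.
  apply/fsetP => x; rewrite in_fsetI; apply/andP/imfsetP => /=.
    move=> [/fset_prodP[d [s [dD]]]]; rewrite in_fset1 => /eqP -> -> xS.
    by exists d => //; rewrite !inE/= dD.
  move=> [d]; rewrite !inE/= => /andP[dD dS] ->; split=> //.
  by apply: mem_fset_prod => //; rewrite in_fset1.
rewrite card_imfset/=; last exact: mulIg.
rewrite card_fset_sum1 big_fset/= [RHS]big_mkcond/=.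
by apply: eq_bigr => d _; case: ifP.
Qed.

(** Double counting: for a fixed [d] the map [g |-> d * g] is injective, so at most [|S|] of the [g]
    send [d] into [S]. *)
Lemma sum_overlap_le D I S :
  (\sum_(g <- I) overlap D S g <= #|` D| * #|` S|)%N.
Proof.
rewrite /overlap exchange_big/=.
apply: (@leq_trans (\sum_(d <- D) #|` S|)%N); last first.
  by rewrite big_const_seq iter_addn_0 count_predT mulnC.
apply: leq_sum => d _.
rewrite -big_mkcond/= sum1_count -size_filter.
rewrite -(size_map (fun g => (d * g)%g)).
apply: uniq_leq_size.
  by rewrite map_inj_uniq; [exact: filter_uniq (fset_uniq _)|exact: mulgI].
by move=> x /mapP[g]; rewrite mem_filter => /andP[gS _] ->.
Qed.
End Tiles.

(** * Greedy filling of a set by translates of a tile *)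

Section Filling.
Context (R : realType) (G : groupType).
Implicit Types (A D I K L P S Om : {fset G}) (g h : G) (e : R).
Local Notation cR A := (#|` A|%:R : R).

Definition fset_inv K : {fset G} := [fset k^-1%g | k in K]%fset.

Lemma mem_fset_inv K k : k \in K -> k^-1%g \in fset_inv K.
Proof. by move=> kK; apply/imfsetP; exists k. Qed.

Lemma overlap_bound_card (c : R) D I S :
  (forall g, g \in I -> c <= (overlap D S g)%:R) ->
  c * cR I <= cR D * cR S.
Proof.
move=> cI; rewrite -natrM.
apply: (@le_trans _ _ (\sum_(g <- I) overlap D S g)%:R); last first.
  by rewrite ler_nat sum_overlap_le.
rewrite natr_sum mulr_natr -(iter_addr_0 _ c) -count_predT -big_const_seq.
rewrite big_seq [leRHS]big_seq; exact: ler_sum.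
Qed.

(** Bounds the number of translates that fit into [Om], which makes a maximal pattern exist. *)
Lemma fsubset_fset_prodl D P Om d :
  d \in D -> (fset_prod D P `<=` Om)%fset ->
  (P `<=` fset_prod (fset_inv D) Om)%fset.
Proof.
move=> dD /fsubsetP DP; apply/fsubsetP => g gP.
rewrite -(mulKg d g); apply: mem_fset_prod; first exact: mem_fset_inv.
exact/DP/mem_fset_prod.
Qed.

(* The pattern is maximal for the number of translates, so that no further
   translate overlaps what is already covered in less than the proportion e. *)
Lemma maximal_pattern e D A Om : e <= 1 -> D != fset0 ->
  exists P, [/\ (fset_prod D P `<=` Om)%fset,
    cR A + (1 - e) * cR D * cR P <= cR (A `|` fset_prod D P)%fset &
    forall g, (fset_prod D [fset g] `<=` Om)%fset ->
      e * cR D <= (overlap D (A `|` fset_prod D P)%fset g)%:R].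
Proof.
move=> e1 /fset0Pn[d0 d0D].
pose ok P := (fset_prod D P `<=` Om)%fset /\
  cR A + (1 - e) * cR D * cR P <= cR (A `|` fset_prod D P)%fset.
pose pn n := `[< exists P, ok P /\ #|` P| = n >].
have ex : exists n, pn n.
  exists 0%N; apply/asboolP; exists fset0; split; last exact: cardfs0.
  by rewrite /ok fset_prod0r; split; rewrite ?fsub0set// cardfs0 mulr0 addr0 fsetU0.
have ub n : pn n -> (n <= #|` fset_prod (fset_inv D) Om|)%N.
  move=> /asboolP[P [[DP _] <-]].
  exact/fsubset_leq_card/(fsubset_fset_prodl d0D).
case: (ex_maxnP ex ub) => n /asboolP[P [[DPOm PA] Pn]] nmax.
exists P; split=> // g gOm.
(* A translate already in the pattern overlaps the covered set completely, and [e <= 1]. *)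
have [gP|gP] := boolP (g \in P).
  suff -> : overlap D (A `|` fset_prod D P)%fset g = #|` D|.
    by rewrite ler_piMl.
  rewrite overlapE -(card_fset_prod1 D g); congr #|` _|.
  apply/fsetIidPl/fsubsetP => x /fset_prodP[d [s [dD]]].
  rewrite in_fset1 => /eqP -> ->.
  by rewrite in_fsetU mem_fset_prod ?orbT.
rewrite leNgt; apply/negP => small.
(* A translate with a small overlap brings at least [(1 - e) * |D|] new points, so it could be added
   to the pattern. *)
have : pn n.+1.
  apply/asboolP; exists (P `|` [fset g])%fset; split; last first.
    by rewrite fsetUC cardfsU1 gP Pn.
  split; first by rewrite fset_prodUr fsubUset DPOm.
  rewrite fset_prodUr fsetUA.
  have -> : cR (P `|` [fset g])%fset = cR P + 1.
    by rewrite fsetUC cardfsU1 gP natrD addrC.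
  have := cardfsUI (fset_prod D [fset g]%fset) (A `|` fset_prod D P)%fset.
  rewrite -overlapE card_fset_prod1 fsetUC => /(congr1 (fun n => n%:R : R)).
  rewrite !natrD => E.
  move: PA small E; move: (cR D) (cR P) (cR A) (cR (A `|` _)%fset).
  by move=> a b c f; nra.
by move=> /nmax; rewrite ltnn.
Qed.

(** By maximality a translate [D g] inside [Om] overlaps the covered set in at least [e * |D|]
    points. If [D g] also misses [A], these points are new, and by double counting [e] times the
    number of such [g] is at most the number of new points. *)
Lemma cover_step e D A Om : 0 <= e <= 1 -> D != fset0 ->
  exists P, [/\ (fset_prod D P `<=` Om)%fset,
    cR A + (1 - e) * cR D * cR P <= cR (A `|` fset_prod D P)%fset &
    e * (cR Om - cR D * cR (fset_prod D Om `\` Om)%fset - cR A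
         - cR (fset_prod (fset_inv D) A `\` A)%fset)
    <= cR (A `|` fset_prod D P)%fset - cR A].
Proof.
move=> /andP[e0 e1] D0.
have [P [DPOm PA Pmax]] := @maximal_pattern e D A Om e1 D0.
exists P; split=> //.
set A' := (A `|` fset_prod D P)%fset in PA Pmax *.
(* [B1] contains every [g] in [Om] for which [D g] leaves [Om]; [A] and [B2] together contain every
   [g] for which [D g] meets [A]. *)
pose B1 := fset_prod (fset_inv D) (fset_prod D Om `\` Om)%fset.
pose B2 := (fset_prod (fset_inv D) A `\` A)%fset.
pose I := (Om `\` (B1 `|` (A `|` B2)))%fset.
have cI : cR Om - cR D * cR (fset_prod D Om `\` Om)%fset - cR A - cR B2 <= cR I.
  have : (#|` Om| <= #|` I| + (#|` B1| + (#|` A| + #|` B2|)))%N.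
    rewrite -(cardfsID (B1 `|` (A `|` B2))%fset Om) addnC leq_add2l.
    apply: leq_trans (fsubset_leq_card (fsubsetIr _ _)) _.
    apply: leq_trans (leq_card_fsetU _ _) _; rewrite leq_add2l.
    exact: leq_trans (leq_card_fsetU _ _) _.
  have : (#|` B1| <= #|` D| * #|` fset_prod D Om `\` Om|)%N%fset.
    apply: leq_trans (card_fset_prod _ _) _.
    by rewrite leq_mul2r leq_imfset_card orbT.
  rewrite -!(ler_nat R) !natrD natrM; lra.
have {}Pmax : forall g, g \in I -> e * cR D <= (overlap D (A' `\` A)%fset g)%:R.
  move=> g; rewrite !(in_fsetD, in_fsetU) !negb_or negb_and negbK.
  move=> /andP[/andP[gB1 /andP[gA gB2]] gOm].
  have {}gB2 : g \notin fset_prod (fset_inv D) A.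
    by move: gB2; rewrite (negbTE gA).
  apply: le_trans (Pmax g _) _.
    apply/fsubsetP => x /fset_prodP[d [s [dD]]]; rewrite in_fset1 => /eqP -> ->.
    apply: contraR gB1 => dgOm; rewrite -(mulKg d g).
    apply: mem_fset_prod; first exact: mem_fset_inv.
    by rewrite in_fsetD dgOm mem_fset_prod.
  rewrite ler_nat /overlap big_seq [leqRHS]big_seq; apply: leq_sum => d dD.
  rewrite in_fsetD; suff -> : (d * g)%g \notin A by [].
  apply: contra gB2 => dgA; rewrite -(mulKg d g).
  by apply: mem_fset_prod => //; exact: mem_fset_inv.
have := overlap_bound_card Pmax.
have -> : cR (A' `\` A)%fset = cR A' - cR A.
  rewrite cardfsDS ?fsubsetUl// natrB//.
  exact/fsubset_leq_card/fsubsetUl.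
have D0R : 0 < cR D by rewrite ltr0n cardfs_gt0.
move=> H; have {H} : e * cR I <= cR A' - cR A.
  by rewrite -(ler_pM2l D0R); move: H; rewrite mulrA (mulrC e).
apply: le_trans; exact: ler_wpM2l.
Qed.
End Filling.

Lemma exprn_small (R : realType) (x r : R) :
  0 <= x < 1 -> 0 < r -> exists k, x ^+ k <= r.
Proof.
move=> /andP[x0 x1] r0.
have /cvgrPdist_le/(_ r r0)[N _ HN] := @cvg_expr R x ltac:(by rewrite ger0_norm).
exists N; have := HN N (leqnn N).
by rewrite sub0r normrN ger0_norm ?exprn_ge0.
Qed.

(** * Quasi-tilings and the limit along increasing invariance *)

Section OrnsteinWeiss.
Context (R : realType) (G : groupType).
Implicit Types (A D K L P S Om : {fset G}) (g h : G) (e : R).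
Local Notation cR A := (#|` A|%:R : R).

Definition almost_invariant K (r : R) S : Prop :=
  cR (fset_prod K S `\` S)%fset <= r * cR S.

Lemma card_leR A S : (A `<=` S)%fset -> cR A <= cR S.
Proof. by move=> AS; rewrite ler_nat; exact: fsubset_leq_card. Qed.

Lemma almost_invariantW K L (r t : R) S : (K `<=` L)%fset -> r <= t ->
  almost_invariant L r S -> almost_invariant K t S.
Proof.
move=> KL rt LS; apply: (@le_trans _ _ (r * cR S)); last exact: ler_wpM2r.
apply: le_trans LS; apply/card_leR/fsetSD/fsubsetP => x.
move=> /fset_prodP[k [s [kK sS ->]]].
by apply: mem_fset_prod => //; exact: (fsubsetP KL).
Qed.

Record invariant_subadditive (phi : {fset G} -> R) (C : R) : Prop := {
  phi0 : phi fset0 = 0;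
  phi_ge0 : forall A, 0 <= phi A;
  phiU : forall A S, phi (A `|` S)%fset <= phi A + phi S;
  phi_translate : forall A g, phi (fset_prod A [fset g])%fset <= phi A;
  phi1_le : forall g, phi [fset g]%fset <= C }.

Variables (phi : {fset G} -> R) (C : R).
Hypothesis phiP : invariant_subadditive phi C.

Lemma phi_le_card A : phi A <= C * cR A.
Proof.
elim/fset1U_rect: A => [|g A gA IH]; first by rewrite cardfs0 mulr0 (phi0 phiP).
apply: le_trans (phiU phiP _ _) _; rewrite cardfsU1 gA natrD mulrDr mulr1.
exact: lerD (phi1_le phiP _) IH.
Qed.

Lemma phi_fset_prod D P : phi (fset_prod D P) <= phi D * cR P.
Proof.
elim/fset1U_rect: P => [|g P gP IH].
  by rewrite fset_prod0r cardfs0 mulr0 (phi0 phiP).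
rewrite fset_prodUr; apply: le_trans (phiU phiP _ _) _.
rewrite cardfsU1 gP natrD mulrDr mulr1.
exact: lerD (phi_translate phiP _ _) IH.
Qed.

(** Bounds the lower limit of [phi D / |D|] along increasing invariance by [l], in the form that
    supplies tiles. *)
Definition frequently_below (l : R) : Prop :=
  forall K r, 0 < r ->
  exists D, [/\ D != fset0, almost_invariant K r D & phi D <= l * cR D].

(** If [k * d * g] lies outside [D P] with [g] in [P], then [k * d] lies outside [D]: a union of
    translates inherits the invariance of its tile, with an error proportional to the number of
    translates. *)
Lemma fset_prodA_setD L D P :
  (fset_prod L (fset_prod D P) `\` fset_prod D P
   `<=` fset_prod (fset_prod L D `\` D) P)%fset.
Proof.
apply/fsubsetP => x; rewrite in_fsetD => /andP[xDP].
move=> /fset_prodP[k [s [kL /fset_prodP[d [g [dD gP ->]]]]]] xE.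
rewrite xE mulgA; apply: mem_fset_prod => //.
rewrite in_fsetD mem_fset_prod// andbT; apply: contra xDP => kdD.
by rewrite xE mulgA mem_fset_prod.
Qed.

(* The last tile [D] is chosen first, so that the earlier rounds can be asked
   to cover a set that is almost invariant under the inverse of [D]. *)
Lemma quasi_tiling e (l : R) (k : nat) : 0 < e < 1 -> 0 <= l ->
  frequently_below l ->
  forall L r, 0 < r -> exists K t, 0 < t /\
    forall Om, almost_invariant K t Om -> exists A,
      [/\ (A `<=` Om)%fset, (1 - e) * phi A <= l * cR A,
          almost_invariant L r A &
          cR (Om `\` A)%fset <= ((1 - e) ^+ k + r) * cR Om].
Proof.
move=> /andP[e0 e1] l0 freq; elim: k => [|k IH] L r r0.
  exists fset0, 1; split=> // Om _; exists fset0; split; rewrite ?fsub0set//.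
  - by rewrite (phi0 phiP) cardfs0 !mulr0.
  - by rewrite /almost_invariant fset_prod0r fset0D cardfs0 mulr0.
  - by rewrite fsetD0 expr0 mulrDl mul1r lerDl mulr_ge0// ltW.
(* The boundary errors are proportional to [|A| + |D| |P|], while the new set is only known to have
   [|A| + (1 - e) |D| |P|] points: the factor [1 - e] makes up for the overlaps. *)
pose r0' := r * (1 - e) / 2.
have r0'0 : 0 < r0' by rewrite /r0'; nra.
have [D [D0 Dinv phiD]] := freq L r0' r0'0.
have D0R : 0 < cR D by rewrite ltr0n cardfs_gt0.
have [K [t [t0 HK]]] := IH (L `|` fset_inv D)%fset r0' r0'0.
(* [cover_step] multiplies the part of [D Om] outside [Om] by [|D|], whence the division by
   [|D|]. *)
exists (K `|` D)%fset, (Num.min t (r / 2 / cR D)); split.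
  by rewrite lt_min t0 !divr_gt0.
move=> Om Ominv.
have [|A [AOm phiA Ainv Acov]] := HK Om.
  apply: almost_invariantW Ominv; first exact: fsubsetUl.
  by rewrite ge_min lexx.
have e01 : 0 <= e <= 1 by rewrite !ltW.
have [P [DPOm A'ge A'cov]] := @cover_step R G e D A Om e01 D0.
set A' := (A `|` fset_prod D P)%fset in A'ge A'cov *.
exists A'; split.
- by rewrite fsubUset AOm.
(* After multiplication by [1 - e] the translates cost at most [l] times [(1 - e) |D| |P|], which is
   their guaranteed gain in points. *)
- have h1 : phi A' <= phi A + phi D * cR P.
    apply: le_trans (phiU phiP _ _) _; rewrite lerD2l; exact: phi_fset_prod.
  have h2 : phi D * cR P <= l * cR D * cR P by exact: ler_wpM2r.
  have h3 : (1 - e) * phi A' <= (1 - e) * (phi A + l * cR D * cR P).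
    apply: ler_wpM2l; lra.
  have h4 : l * (cR A + (1 - e) * cR D * cR P) <= l * cR A'.
    exact: ler_wpM2l.
  lra.
- have L1 : cR (fset_prod L A `\` A)%fset <= r0' * cR A.
    by apply: almost_invariantW Ainv => //; exact: fsubsetUl.
  have L2 : cR (fset_prod L (fset_prod D P) `\` fset_prod D P)%fset
      <= r0' * cR D * cR P.
    apply: (@le_trans _ _ (cR (fset_prod L D `\` D)%fset * cR P)).
      rewrite -natrM ler_nat; apply: leq_trans (card_fset_prod _ _).
      exact/fsubset_leq_card/fset_prodA_setD.
    exact: ler_wpM2r.
  have L3 : cR (fset_prod L A' `\` A')%fset <=
      cR (fset_prod L A `\` A)%fset +
      cR (fset_prod L (fset_prod D P) `\` fset_prod D P)%fset.
    rewrite -natrD ler_nat; apply: leq_trans (leq_card_fsetU _ _).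
    apply: fsubset_leq_card; rewrite fset_prodUr; apply/fsubsetP => x.
    rewrite !(in_fsetD, in_fsetU) negb_or => /andP[/andP[-> ->]].
    by rewrite !andTb.
  have := ler_wpM2l (ltW r0) A'ge.
  have : 0 <= r * cR A by rewrite mulr_ge0// ltW.
  have : 0 <= r * e * cR A by rewrite !mulr_ge0// ltW.
  have : 0 <= r * cR D * cR P by rewrite !mulr_ge0// ltW.
  have : 0 <= r * (1 - e) * cR D * cR P.
    by rewrite !mulr_ge0 ?subr_ge0// ltW.
  have : 0 <= r * (1 - e) * cR A.
    by rewrite !mulr_ge0 ?subr_ge0// ltW.
  rewrite /almost_invariant /r0' in L1 L2 L3 *; nra.
- have A'Om : (A' `<=` Om)%fset by rewrite fsubUset AOm.
  have cardD S : (S `<=` Om)%fset -> cR (Om `\` S)%fset = cR Om - cR S.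
    by move=> SOm; rewrite cardfsDS// natrB//; exact: fsubset_leq_card.
  rewrite (cardD _ AOm) in Acov; rewrite (cardD _ A'Om).
  have D1 : cR (fset_prod (fset_inv D) A `\` A)%fset <= r0' * cR Om.
    apply: (@le_trans _ _ (r0' * cR A)).
      by apply: almost_invariantW Ainv => //; exact: fsubsetUr.
    by apply: ler_wpM2l; [exact: ltW|exact: card_leR].
  have D2 : cR D * cR (fset_prod D Om `\` Om)%fset <= r / 2 * cR Om.
    have -> : r / 2 * cR Om = cR D * (r / 2 / cR D * cR Om).
      by field; rewrite gt_eqF.
    apply: ler_wpM2l => //; apply: almost_invariantW Ominv.
      exact: fsubsetUr.
    by rewrite ge_min lexx orbT.
  (* The round multiplies the uncovered part by [1 - e]; the three error terms add up to
     [r / 2 * cR Om]. *)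
  rewrite exprS; move: Acov A'cov D1 D2; rewrite /r0'.
  have := ler0n R #|` Om|.
  move: (cR Om) (cR A) (cR A') (cR D * _) (cR (fset_prod (fset_inv D) A `\` A)%fset).
  move: ((1 - e) ^+ k) => c om a a' u v om0 h1 h2 h3 h4.
  have h5 : (1 - e) * (om - a) <= (1 - e) * ((c + r * (1 - e) / 2) * om).
    by apply: ler_wpM2l => //; lra.
  have h6 : e * u <= e * (r / 2 * om) by apply: ler_wpM2l => //; lra.
  have h7 : e * v <= e * (r * (1 - e) / 2 * om) by apply: ler_wpM2l => //; lra.
  have h8 : 0 <= r * om by rewrite mulr_ge0// ltW.
  have h9 : 0 <= e * (r * om) by rewrite mulr_ge0// ltW.
  lra.
Qed.

(** The quasi-tiled part [A] costs at most [l / (1 - e)] per point; the remainder has at most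
    [2 * r * |Om|] points, each costing at most [C]. *)
Lemma below_of_frequently (l eta : R) : 0 <= l -> frequently_below l ->
  0 < eta -> exists K t, 0 < t /\
    forall Om, almost_invariant K t Om -> phi Om <= (l + eta) * cR Om.
Proof.
move=> l0 freq eta0.
have C0 : 0 <= C.
  exact: le_trans (phi_ge0 phiP [fset 1%g]%fset) (phi1_le phiP _).
(* Chosen so that [l <= (1 - e) * (l + eta / 2)]. *)
pose e := Num.min (1 / 2) (eta / (4 * (l + 1))).
have e0 : 0 < e by rewrite lt_min !divr_gt0 ?mulr_gt0// ltr_wpDl.
have e2 : e <= 1 / 2 by rewrite ge_min lexx.
have el : e * (4 * (l + 1)) <= eta.
  by rewrite -ler_pdivlMr ?mulr_gt0 ?ltr_wpDl// ge_min lexx orbT.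
(* Keeps the cost [2 * r * C] of the remainder below [eta / 4]. *)
pose r := eta / (8 * (C + 1)).
have r0 : 0 < r by rewrite divr_gt0 ?mulr_gt0 ?ltr_wpDl.
have rC : r * (8 * (C + 1)) = eta.
  by rewrite /r mulfVK// gt_eqF// mulr_gt0 ?ltr_wpDl.
have [k kr] : exists k, (1 - e) ^+ k <= r by apply: exprn_small => //; lra.
have e01 : 0 < e < 1 by lra.
have [K [t [t0 HK]]] := @quasi_tiling e l k e01 l0 freq fset0 r r0.
exists K, t; split=> // Om /HK[A [AOm phiA _ Acov]].
have h1 : phi Om <= phi A + phi (Om `\` A)%fset.
  have {1}-> : Om = (A `|` Om `\` A)%fset; last exact: (phiU phiP).
  apply/fsetP => x; rewrite in_fsetU in_fsetD.
  by have [/(fsubsetP AOm)|] := boolP (x \in A).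
have h2 : phi (Om `\` A)%fset <= C * (2 * r * cR Om).
  apply: le_trans (phi_le_card _) _; apply: ler_wpM2l => //.
  by apply: le_trans Acov _; apply: ler_wpM2r => //; lra.
have h3 : l * cR A <= l * cR Om by apply: ler_wpM2l => //; exact: card_leR.
have om0 : 0 <= cR Om by [].
have h4 : (1 - e) * (phi A) <= (1 - e) * ((l + eta / 2) * cR Om).
  apply: le_trans phiA (le_trans h3 _).
  have : 0 <= (4 * (eta - e * (4 * (l + 1)))) * cR Om.
    by apply: mulr_ge0 => //; lra.
  have : 0 <= (e * l) * cR Om by rewrite !mulr_ge0// ltW.
  have : 0 <= (eta * (1 / 2 - e)) * cR Om.
    by apply: mulr_ge0 => //; apply: mulr_ge0; lra.
  nra.
rewrite ler_pM2l in h4; last lra.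
have h5 : 0 <= (eta - r * (8 * C)) * cR Om.
  by apply: mulr_ge0 => //; lra.
have h6 : 0 <= eta * cR Om by rewrite mulr_ge0// ltW.
nra.
Qed.

(* The Ornstein-Weiss lemma, with the limit taken along increasing
   invariance instead of along a Folner net. *)
Lemma Ornstein_Weiss : exists h : R, forall eta, 0 < eta ->
  exists K t, 0 < t /\ forall Om, almost_invariant K t Om ->
    (h - eta) * cR Om <= phi Om <= (h + eta) * cR Om.
Proof.
(* [inf B] is the upper limit of [phi Om / |Om|] along increasing invariance. *)
pose B := [set l : R | 0 <= l /\ exists K t, 0 < t /\
  forall Om, almost_invariant K t Om -> phi Om <= l * cR Om].
have C0 : 0 <= C.
  exact: le_trans (phi_ge0 phiP [fset 1%g]%fset) (phi1_le phiP _).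
have BC : B C.
  split=> //; exists fset0, 1; split=> // Om _; exact: phi_le_card.
have infB : has_inf B by split; [exists C|exists 0 => l []].
exists (inf B) => eta eta0.
have [l [l0 [K [t [t0 HK]]]] ltl] := inf_adherent eta0 infB.
have [K' [t' [t'0 HK']]] : exists K t, 0 < t /\
    forall Om, almost_invariant K t Om -> (inf B - eta) * cR Om <= phi Om.
  (* Otherwise [phi] is frequently below [inf B - eta], hence by quasi-tiling eventually below
     [inf B - eta / 2], which would then belong to [B]. *)
  apply: contrapT => noK.
  have freq : frequently_below (inf B - eta).
    move=> L r r0; apply: contrapT => noD; apply: noK.
    exists L, r; split=> // Om Ominv; rewrite leNgt; apply/negP => lt.
    apply: noD; exists Om; split=> //; last exact: ltW.
    apply/eqP => Om0; move: lt.
    by rewrite Om0 cardfs0 mulr0 (phi0 phiP) ltxx.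
  have l'0 : 0 <= inf B - eta.
    have [D [D0 _ phiD]] := freq fset0 1 ltr01.
    have D0R : 0 < cR D by rewrite ltr0n cardfs_gt0.
    by rewrite -(pmulr_lge0 _ D0R); exact: le_trans (phi_ge0 phiP D) phiD.
  have eta2 : 0 < eta / 2 by rewrite divr_gt0.
  have Bl : B (inf B - eta + eta / 2).
    by split; [lra|exact: below_of_frequently].
  have := ge_inf infB.2 Bl; lra.
exists (K `|` K')%fset, (Num.min t t'); split; first by rewrite lt_min t0.
move=> Om Ominv; apply/andP; split.
  apply: HK'; apply: almost_invariantW Ominv; first exact: fsubsetUr.
  by rewrite ge_min lexx orbT.
apply: (@le_trans _ _ (l * cR Om)); last by apply: ler_wpM2r => //; exact: ltW.
apply: HK; apply: almost_invariantW Ominv; first exact: fsubsetUl.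
by rewrite ge_min lexx.
Qed.
End OrnsteinWeiss.

(** * Entropy of covers *)

Section CoverNumber.
Context (R : realType) (X : topologicalType).
Implicit Types (U : set (set X)) (V : {fset (set X)}) (s : seq (set X)).
Local Notation N := (cover_number R).

(* The members of [s] need not be distinct nor belong to [U]: they only
   refine it. *)
Lemma cover_number_le U s :
  (forall x, exists2 A, A \in s & A x) ->
  (forall A, A \in s -> exists2 B, U B & A `<=` B) ->
  (N U <= (size s)%:R%:E)%E.
Proof.
move=> s_cover s_refine.
have /choice[f fP] : forall A, exists B, A \in s -> U B /\ A `<=` B.
  move=> A; have [/s_refine[B UB AB]|_] := boolP (A \in s); last by exists set0.
  by exists B.
pose V := seq_fset tt [seq f A | A <- s].
apply: (@le_trans _ _ (#|` V|%:R)%:E).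
  apply: ereal_inf_lbound; exists V => //; split.
    move=> B /=; rewrite seq_fsetE => /mapP[A As ->].
    by have [] := fP A As.
  rewrite /set_cover -subTset => x _.
  have [A As Ax] := s_cover x; exists (f A); last by have [_] := fP A As; exact.
  by rewrite /= seq_fsetE map_f.
rewrite lee_fin ler_nat size_seq_fset (leq_trans (size_undup _))//.
by rewrite size_map.
Qed.

(** The values are natural numbers, so a finite infimum is a minimum. *)
Lemma cover_number_attained U : (N U < +oo)%E ->
  exists V, [/\ [set` V] `<=` U, set_cover [set` V] & N U = #|` V|%:R%:E].
Proof.
move=> /ereal_inf_lt[_ [V0 [V0U V0c] <-] _].
pose sub n := `[< exists V,
  [/\ [set` V] `<=` U, set_cover [set` V] & #|` V| = n] >].
have ex : exists n, sub n by exists #|` V0|; apply/asboolP; exists V0.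
case: (ex_minnP ex) => n /asboolP[V [VU Vc Vn]] nmin.
exists V; split=> //; apply/eqP; rewrite eq_le; apply/andP; split.
  by apply: ereal_inf_lbound; exists V.
apply: le_ereal_inf_tmp => _ [V' [V'U V'c] <-].
by rewrite lee_fin ler_nat Vn; apply: nmin; apply/asboolP; exists V'.
Qed.

Lemma cover_number_ge0 U : (0 <= N U)%E.
Proof. by apply: le_ereal_inf_tmp => _ [V _ <-]; rewrite lee_fin. Qed.

Lemma cover_number_ge1 U (x : X) : (1 <= N U)%E.
Proof.
apply: le_ereal_inf_tmp => _ [V [_ Vc] <-]; rewrite lee_fin ler1n cardfs_gt0.
apply/eqP => V0; have : setT x by [].
by rewrite -Vc => -[A]; rewrite /= V0.
Qed.

(** Serves the degenerate space, where the logarithms are [-oo] and the real-valued Ornstein-Weiss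
    lemma does not apply. *)
Lemma cover_number_empty U : [set: X] = set0 -> N U = 0%E.
Proof.
move=> X0; apply/eqP; rewrite eq_le cover_number_ge0 andbT.
by apply: (@cover_number_le U [::]) => // x; have : [set: X] x by []; rewrite X0.
Qed.
End CoverNumber.

(** * Subadditivity and translation of the cover numbers of joins *)

Section JoinNumber.
Context (R : realType) (Gamma : groupType) (X : topologicalType).
Variable alpha : Gamma -> X -> X.
Hypothesis alphaM : forall g h x, alpha (g * h)%g x = alpha g (alpha h x).
Variables (U : set (set X)) (W : {fset (set X)}).
Hypotheses (UW : U = [set` W]) (U_cover : set_cover U).
Implicit Types (F : {fset Gamma}) (g : Gamma).

Local Notation N F := (cover_number R (cover_join alpha U F)).

Lemma cover_join0 : cover_join alpha U fset0 [set: X].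
Proof.
exists (fun _ => setT) => //.
by apply/seteqP; split=> // x _ g.
Qed.

Lemma joinN0_le1 : (N fset0 <= 1)%E.
Proof.
apply: (@cover_number_le _ _ _ [:: setT]) => [x|A].
  by exists setT; rewrite ?mem_seq1.
by rewrite mem_seq1 => /eqP ->; exists setT => //; exact: cover_join0.
Qed.

Lemma joinN1_le g : (N [fset g]%fset <= #|` W|%:R%:E)%E.
Proof.
have -> : #|` W| = size [seq alpha g @^-1` A | A <- W] by rewrite size_map.
apply: cover_number_le => [x|A].
  have : setT (alpha g x) by [].
  rewrite -U_cover UW => -[A AW Agx]; exists (alpha g @^-1` A) => //.
  exact: map_f.
move=> /mapP[B BW ->]; exists (alpha g @^-1` B) => //.
exists (fun _ => B) => /=; first by move=> h _; rewrite UW.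
apply/seteqP; split=> x; first by apply; rewrite /= in_fset1.
by move=> Bx h; rewrite /= in_fset1 => /eqP ->.
Qed.

(** Intersects two minimal subcovers pairwise. At places common to [A] and [B] only the first choice
    is kept, so the intersections refine the join without having to belong to it. *)
Lemma joinNU (m n : nat) (A B : {fset Gamma}) :
  N A = m%:R%:E -> N B = n%:R%:E -> (N (A `|` B)%fset <= (m * n)%:R%:E)%E.
Proof.
move=> NA NB.
have [VA [VAU VAc]] : exists V, [/\ [set` V] `<=` cover_join alpha U A,
    set_cover [set` V] & N A = #|` V|%:R%:E].
  by apply: cover_number_attained; rewrite NA ltry.
have [VB [VBU VBc]] : exists V, [/\ [set` V] `<=` cover_join alpha U B,
    set_cover [set` V] & N B = #|` V|%:R%:E].
  by apply: cover_number_attained; rewrite NB ltry.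
rewrite NA NB => - [/eqP +] [/eqP].
rewrite !eqr_nat => /eqP -> /eqP ->.
rewrite -(size_allpairs (@setI X)).
apply: cover_number_le => [x|C].
  have : setT x by []. rewrite -{1}VAc => -[a aV ax].
  have : setT x by []. rewrite -VBc => -[b bV bx].
  by exists (a `&` b) => //; apply/allpairsP; exists (a, b).
move=> /allpairsP[[a b] /= [/VAU[u uU <-] /VBU[v vU <-] ->]].
pose w g := if g \in A then u g else v g.
exists (\bigcap_(g in [set` (A `|` B)%fset]) (alpha g @^-1` w g)).
  exists w => // g; rewrite in_fsetU /w.
  by have [gA _|_ /= gB] := boolP (g \in A); [exact: uU|exact: vU].
move=> x [ux vx] g; rewrite /= in_fsetU /w.
by have [gA _|_ /= gB] := boolP (g \in A); [exact: ux|exact: vx].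
Qed.

Lemma joinN_fin F : exists n : nat, N F = n%:R%:E.
Proof.
suff : (N F < +oo)%E by move=> /cover_number_attained[V [_ _ ->]]; exists #|` V|.
elim/fset1U_rect: F => [|g F _]; first exact: le_lt_trans joinN0_le1 (ltry _).
move=> /cover_number_attained[V [_ _ NV]].
have /cover_number_attained[V1 [_ _ NV1]] : (N [fset g]%fset < +oo)%E.
  exact: le_lt_trans (joinN1_le g) (ltry _).
exact: le_lt_trans (joinNU NV1 NV) (ltry _).
Qed.

(** Pulling a subcover back along [alpha g] moves the condition at [k] to the place [k * g]; hence
    the choice at [h] is read off at [h * g^-1]. *)
Lemma joinN_translate F g : (N (fset_prod F [fset g])%fset <= N F)%E.
Proof.
have [n NF] := joinN_fin F.
have [V [VU Vc]] : exists V, [/\ [set` V] `<=` cover_join alpha U F,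
    set_cover [set` V] & N F = #|` V|%:R%:E].
  by apply: cover_number_attained; rewrite NF ltry.
move=> ->.
have -> : #|` V| = size [seq alpha g @^-1` A | A <- V] by rewrite size_map.
apply: cover_number_le => [x|A].
  have : setT (alpha g x) by [].
  rewrite -Vc => -[A AV Agx]; exists (alpha g @^-1` A) => //; exact: map_f.
move=> /mapP[B /VU[u uU <-] ->].
exists (\bigcap_(h in [set` fset_prod F [fset g]%fset])
    (alpha h @^-1` u (h * g^-1)%g)).
  exists (fun h => u (h * g^-1)%g) => // h /fset_prodP[k [s [kF]]].
  by rewrite in_fset1 => /eqP -> ->; rewrite mulgK; exact: uU.
move=> x xu h /fset_prodP[k [s [kF]]]; rewrite in_fset1 => /eqP -> ->.
by rewrite /= mulgK alphaM; exact: xu.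
Qed.

(** The point [x0] makes all cover numbers at least 1, so that their logarithms are nonnegative and
    turn products into sums. *)
Lemma ln_joinN_subadditive (x0 : X) :
  invariant_subadditive (fun F => ln (fine (N F))) (ln (#|` W|%:R)).
Proof.
have Npos F : (fine (N F) \is Num.pos)%R.
  have [n NF] := joinN_fin F.
  have := cover_number_ge1 R (cover_join alpha U F) x0.
  rewrite NF /= lee_fin posrE => h; exact: lt_le_trans h.
have Nge1 F : 1 <= fine (N F).
  have [n NF] := joinN_fin F.
  by have := cover_number_ge1 R (cover_join alpha U F) x0; rewrite NF lee_fin.
have NE F : N F = (fine (N F))%:E by have [n ->] := joinN_fin F.
have Wpos : (#|` W|%:R : R) \is Num.pos.
  rewrite posrE ltr0n cardfs_gt0; apply/eqP => W0.
  have : setT x0 by [].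
  by rewrite -U_cover UW W0 => -[A].
split.
- have -> : fine (N fset0) = 1; last exact: ln1.
  by apply/eqP; rewrite eq_le Nge1 andbT -lee_fin -NE joinN0_le1.
- by move=> F; exact: ln_ge0.
- move=> A B; rewrite -lnM// ler_ln//; last first.
    by rewrite posrE mulr_gt0// -posrE.
  rewrite -lee_fin -NE.
  have [m NA] := joinN_fin A; have [n NB] := joinN_fin B.
  by rewrite NA NB /= -natrM; exact: joinNU.
- by move=> A g; rewrite ler_ln// -lee_fin -!NE; exact: joinN_translate.
- by move=> g; rewrite ler_ln// -lee_fin -NE; exact: joinN1_le.
Qed.
End JoinNumber.

(** * Upper and lower limits along nets *)

Section Nets.
Context (R : realType) (d : Order.disp_t) (J : preorderType d).
Hypothesis J_directed : directed J.
Implicit Types (u v : J -> \bar R).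

Lemma net_filter_proper : ProperFilter (net_filter J).
Proof.
case: J_directed => J0 Jdir; apply: filter_from_proper; last first.
  by move=> j _; exists j => /=; exact: lexx.
apply: filter_from_filter; first exact: J0.
move=> i j _ _; have [k [ik jk]] := Jdir i j.
by exists k => // l /= kl; split; exact: le_trans kl.
Qed.

Lemma net_limsup_le u (a : \bar R) :
  (\forall n \near net_filter J, u n <= a)%E -> (net_limsup u <= a)%E.
Proof.
move=> [j _ uj].
apply: (@le_trans _ _ (ereal_sup [set u k | k in [set k | (j <= k)%O]])).
  by apply: ereal_inf_lbound; exists j.
by apply: ge_ereal_sup => _ [k /uj ? <-].
Qed.

Lemma net_liminf_ge u (a : \bar R) :
  (\forall n \near net_filter J, a <= u n)%E -> (a <= net_liminf u)%E.
Proof.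
move=> [j _ uj].
apply: (@le_trans _ _ (ereal_inf [set u k | k in [set k | (j <= k)%O]])).
  by apply: le_ereal_inf_tmp => _ [k /uj ? <-].
by apply: ereal_sup_ubound; exists j.
Qed.

Lemma net_liminf_le_limsup u : (net_liminf u <= net_limsup u)%E.
Proof.
apply: ge_ereal_sup => _ [i _ <-]; apply: le_ereal_inf_tmp => _ [j _ <-].
have [k [ik jk]] := J_directed.2 i j.
apply: (@le_trans _ _ (u k)).
  by apply: ereal_inf_lbound; exists k.
by apply: ereal_sup_ubound; exists k.
Qed.

Lemma le_net_limsup u v : (forall n, u n <= v n)%E ->
  (net_limsup u <= net_limsup v)%E.
Proof.
move=> uv; apply: le_ereal_inf_tmp => _ [j _ <-].
apply: (@le_trans _ _ (ereal_sup [set u k | k in [set k | (j <= k)%O]])).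
  by apply: ereal_inf_lbound; exists j.
apply: ge_ereal_sup => _ [k jk <-]; apply: le_trans (uv k) _.
by apply: ereal_sup_ubound; exists k.
Qed.

Lemma le_net_liminf u v : (forall n, u n <= v n)%E ->
  (net_liminf u <= net_liminf v)%E.
Proof.
move=> uv; apply: ge_ereal_sup => _ [j _ <-].
apply: (@le_trans _ _ (ereal_inf [set v k | k in [set k | (j <= k)%O]])).
  apply: le_ereal_inf_tmp => _ [k jk <-]; apply: le_trans (uv k).
  by apply: ereal_inf_lbound; exists k.
by apply: ereal_sup_ubound; exists j.
Qed.

Lemma Folner_almost_invariant (Gamma : groupType) (F : J -> {fset Gamma})
    (K : {fset Gamma}) (t : R) : left_Folner_net R F -> 0 < t ->
  \forall n \near net_filter J, almost_invariant K t (F n).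
Proof.
move=> [_ F0 Finv] t0; have PF := net_filter_proper.
(* The Folner condition speaks of nonempty sets only; adding the unit covers an empty [K]. *)
have K1 : (1%g |` K)%fset != fset0.
  by apply/fset0Pn; exists 1%g; rewrite fset1U1.
have /cvgrPdist_le/(_ t t0) := Finv _ K1.
apply: filterS => n; rewrite sub0r normrN ger0_norm ?divr_ge0//.
rewrite ler_pdivrMr ?ltr0n ?cardfs_gt0// => H.
apply: (@almost_invariantW _ _ _ (1%g |` K)%fset t) => //.
  exact: fsubsetUr.
apply: le_trans H; rewrite /fset_symdiff; apply: card_leR.
exact: fsubsetUl.
Qed.
End Nets.

(** * Existence of the entropy of a cover *)

Section CoverEntropy.
Context (R : realType) (Gamma : groupType) (X : topologicalType).
Variable alpha : Gamma -> X -> X.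
Hypothesis alphaM : forall g h x, alpha (g * h)%g x = alpha g (alpha h x).
Variables (U : set (set X)).
Hypotheses (U_fin : finite_set U) (U_cover : set_cover U).

Lemma normalized_log_EFin (A : {fset Gamma}) (a : R) : 0 < a ->
  normalized_log A a%:E = (ln a / #|` A|%:R)%:E.
Proof. by move=> a0; rewrite /normalized_log lne_EFin// -EFinM mulrC. Qed.

Lemma normalized_log0 (A : {fset Gamma}) : A != fset0 ->
  normalized_log A 0%E = -oo%E :> \bar R.
Proof.
by move=> A0; rewrite /normalized_log le0_lneNy// gt0_muleNy// lte_fin invr_gt0
  ltr0n cardfs_gt0.
Qed.

Lemma le_normalized_log (A : {fset Gamma}) (a b : \bar R) :
  (0 <= a)%E -> (a <= b)%E -> (normalized_log A a <= normalized_log A b)%E.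
Proof.
move=> a0 ab; apply: lee_wpmul2l; first by rewrite lee_fin invr_ge0.
rewrite lee_lne// in_itv/= leey andbT//; exact: le_trans ab.
Qed.

(** Since [htop_cover] is chosen by [xget], it is enough to exhibit one limit common to all Folner
    nets. The number given by [Ornstein_Weiss] is found before any net is fixed. *)
Lemma htop_coverP (d : Order.disp_t) (J : preorderType d)
    (F : J -> {fset Gamma}) : left_Folner_net R F ->
  normalized_log (F n) (cover_number R (cover_join alpha U (F n)))
    @[n --> net_filter J] --> htop_cover R alpha U.
Proof.
move: d J F; apply: (@xgetPex _ 0%E [set h : \bar R |
  forall (d : Order.disp_t) (J : preorderType d) (F : J -> {fset Gamma}),
    left_Folner_net R F ->
    normalized_log (F n) (cover_number R (cover_join alpha U (F n)))
      @[n --> net_filter J] --> h]).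
have [X0|] := eqVneq [set: X] set0.
  exists -oo%E => d J F [Jdir F0 _]; have PF := net_filter_proper Jdir.
  under eq_fun => n do rewrite cover_number_empty// normalized_log0//.
  exact: cvg_cst.
move=> /set0P[x0 _].
have [W UW] := (finite_fsetP.1 U_fin).
have phiP := @ln_joinN_subadditive R Gamma X alpha alphaM U W UW U_cover x0.
have [h hP] := Ornstein_Weiss phiP.
exists h%:E => d J F FF; have [Jdir F0 _] := FF.
have PF := net_filter_proper Jdir.
have E n : normalized_log (F n) (cover_number R (cover_join alpha U (F n))) =
    (ln (fine (cover_number R (cover_join alpha U (F n)))) / #|` F n|%:R)%:E.
  have [m Nm] := @joinN_fin R Gamma X alpha U W UW U_cover (F n).
  rewrite Nm normalized_log_EFin//.
  have := cover_number_ge1 R (cover_join alpha U (F n)) x0.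
  rewrite Nm /= lee_fin => m1; exact: lt_le_trans m1.
under eq_fun => n do rewrite E.
apply: cvg_EFin; first by near=> n.
apply/cvgrPdist_le => eta eta0.
have [K [t [t0 HK]]] := hP eta eta0.
have := @Folner_almost_invariant R d J Jdir Gamma F K t FF t0.
apply: filterS => n /HK /andP[lo hi] /=.
have Fn0 : 0 < #|` F n|%:R :> R by rewrite ltr0n cardfs_gt0.
rewrite distrC ler_distl.
by rewrite ler_pdivlMr// ler_pdivrMr// lo hi.
Unshelve. all: by end_near. Qed.
End CoverEntropy.

(** * Covers generated by a pseudometric *)

(** An alias of [T] whose type records the closure properties of [op], so that the topology attached
    to it does not clash with one already on [T]. *)
Definition open_family_space (T : choiceType) (op : set_system T)
  of op setT & setI_closed op &
     (forall (I : Type) (f : I -> set T), (forall i, op (f i)) ->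
       op (\bigcup_i f i)) : Type := T.

Section OpenFamilySpace.
Context (T : choiceType) (op : set_system T) (opT : op setT)
  (opI : setI_closed op)
  (opU : forall (I : Type) (f : I -> set T), (forall i, op (f i)) ->
    op (\bigcup_i f i)).

HB.instance Definition _ := Choice.copy (open_family_space opT opI opU) T.
HB.instance Definition _ :=
  isOpenTopological.Build (open_family_space opT opI opU) opT opI opU.
End OpenFamilySpace.

Section Generated.
Context (R : realType) (Gamma : groupType) (X : topologicalType).
Variables (alpha : Gamma -> X -> X) (theta : X -> X -> R).
Hypothesis theta_refl : forall x, theta x x = 0.
Hypothesis theta_sym : forall x y, theta x y = theta y x.
Hypothesis theta_tri : forall x y z, theta x z <= theta x y + theta y z.
Implicit Types (K : {fset Gamma}) (g : Gamma) (x y : X) (A : set X).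

(** The ball of the maximum pseudometric over [K]; for empty [K] it is the whole space. *)
Definition orbit_ball K (e : R) x : set X :=
  [set y | forall g, g \in K -> theta (alpha g x) (alpha g y) < e].

Lemma orbit_ballW K L (e f : R) x : (K `<=` L)%fset -> e <= f ->
  orbit_ball L e x `<=` orbit_ball K f x.
Proof.
move=> KL ef y xy g gK; apply: lt_le_trans ef; apply: xy.
exact: (fsubsetP KL).
Qed.

Lemma ball_generated g x (e : R) :
  generated_set alpha theta [set y | theta (alpha g x) (alpha g y) < e].
Proof.
move=> T XT cont.
apply: (@open_comp XT R (fun y : XT => theta (alpha g x) (alpha g y))
  [set r | r < e]); last exact: open_lt.
move=> y _.
apply: (@continuous_comp XT (XT * XT)%type R (fun y : XT => (x : XT, y))
  (fun z => theta (alpha g (z.1 : X)) (alpha g (z.2 : X)))); last exact: cont.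
by apply: cvg_pair; [exact: cvg_cst|exact: cvg_id].
Qed.

(* The sets [op] below form a topology making the pseudometrics continuous. *)
Lemma generated_ball A x : generated_set alpha theta A -> A x ->
  exists K (e : R), 0 < e /\ orbit_ball K e x `<=` A.
Proof.
pose op B := forall x, B x -> exists K e, 0 < e /\ orbit_ball K e x `<=` B.
have opT : op setT by move=> y _; exists fset0, 1.
have opI : setI_closed op.
  move=> B C opB opC y [By Cy].
  have [K [e [e0 KB]]] := opB _ By; have [L [f [f0 LC]]] := opC _ Cy.
  exists (K `|` L)%fset, (Num.min e f); split; first by rewrite lt_min e0.
  move=> z yz; split; [apply: KB|apply: LC]; apply: orbit_ballW yz.
  - exact: fsubsetUl.
  - by rewrite ge_min lexx.
  - exact: fsubsetUr.
  - by rewrite ge_min lexx orbT.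
have opU (I : Type) (f : I -> set X) : (forall i, op (f i)) ->
    op (\bigcup_i f i).
  move=> opf y [i _ fiy]; have [K [e [e0 Kf]]] := opf i _ fiy.
  by exists K, e; split=> // z /Kf fz; exists i.
pose TT := Topological.class (open_family_space opT opI opU).
move=> genA Ax; suff : op A by apply.
have := genA TT; apply => g.
set XT := Topological.Pack TT.
have nbhs_ball (a : XT) (e : R) : 0 < e ->
    nbhs a [set y : XT | theta (alpha g a) (alpha g y) < e].
  move=> e0; apply: open_nbhs_nbhs; split; last by rewrite /= theta_refl.
  move=> y /= ay; exists [fset g]%fset.
  exists (e - theta (alpha g a) (alpha g y)); split; first by rewrite subr_gt0.
  move=> z /(_ g); rewrite in_fset1 eqxx => /(_ isT) yz /=.
  by have := theta_tri (alpha g a) (alpha g y) (alpha g z); lra.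
move=> [a b]; apply/cvgrPdist_lt => e e0 /=.
have e2 : 0 < e / 2 by rewrite divr_gt0.
(* By the triangle inequality two values of a pseudometric differ by at most the sum of the
   distances between the first and between the second arguments. *)
exists ([set y : XT | theta (alpha g a) (alpha g y) < e / 2],
        [set y : XT | theta (alpha g b) (alpha g y) < e / 2]).
  by split; exact: nbhs_ball.
move=> [y z] [/= ay bz]; rewrite ltr_norml.
have := theta_tri (alpha g a) (alpha g y) (alpha g b).
have := theta_tri (alpha g y) (alpha g z) (alpha g b).
have := theta_tri (alpha g y) (alpha g a) (alpha g z).
have := theta_tri (alpha g a) (alpha g b) (alpha g z).
rewrite (theta_sym (alpha g z) (alpha g b)) (theta_sym (alpha g y) (alpha g a)).
by move=> *; lra.
Qed.

Hypothesis theta_cont : continuous (fun z : X * X => theta z.1 z.2).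
Hypothesis alpha_cont : forall g, continuous (alpha g).

Lemma theta_ball_open g x (e : R) :
  open [set y | theta (alpha g x) (alpha g y) < e].
Proof.
apply: (@open_comp X R (fun y => theta (alpha g x) (alpha g y))
  [set r | r < e]); last exact: open_lt.
move=> y _.
apply: (@continuous_comp X (X * X)%type R (fun y => (alpha g x, alpha g y))
  (fun z => theta z.1 z.2)); last exact: theta_cont.
by apply: cvg_pair; [exact: cvg_cst|exact: alpha_cont].
Qed.

Lemma orbit_ball_nbhs K (e : R) x : 0 < e -> nbhs x (orbit_ball K e x).
Proof.
move=> e0; elim/fset1U_rect: K => [|g K gK IH].
  by apply: filterS filterT => y _ g.
have gx : nbhs x [set y | theta (alpha g x) (alpha g y) < e].
  apply: open_nbhs_nbhs; split; first exact: theta_ball_open.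
  by rewrite /= theta_refl.
near=> y => h; rewrite in_fset1U => /orP[/eqP ->|hK].
  by near: y.
by move: h hK; near: y.
Unshelve. all: by end_near. Qed.

(** Each point has a pair [(K, e)] that works near it; compactness makes this uniform along the
    filter of pairs with [K] growing and [e] shrinking to 0. *)
Lemma Lebesgue_number U : compact [set: X] -> set_cover U ->
  generated_cover alpha theta U ->
  exists K (e : R), 0 < e /\ forall x, exists2 A, U A & orbit_ball K e x `<=` A.
Proof.
move=> /compact_near_coveringP Xcov Ucov Ugen.
pose FI : set_system ({fset Gamma} * R) := filter_from
  [set i : {fset Gamma} * R | 0 < i.2]
  (fun i => [set j | (i.1 `<=` j.1)%fset /\ 0 < j.2 <= i.2]).
have FF : Filter FI.
  apply: filter_from_filter; first by exists (fset0, 1) => /=.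
  move=> [K e] [L f] /= e0 f0; exists ((K `|` L)%fset, Num.min e f) => /=.
    by rewrite lt_min e0.
  move=> [M h] /= [KLM /andP[h0 hef]].
  rewrite fsubUset in KLM; case/andP: KLM => KM LM.
  by move: hef; rewrite le_min => /andP[he hf]; rewrite h0.
have /Xcov : forall x, [set: X] x -> \forall x' \near x & i \near FI,
    exists2 A, U A & orbit_ball i.1 i.2 x' `<=` A.
  move=> x _; have : setT x by []. rewrite -Ucov => -[A UA Ax].
  have [K [e [e0 KA]]] := generated_ball (Ugen _ UA) Ax.
  (* One half of the radius is spent on moving the centre from [x] to [x'], the other on the ball
     around [x']. *)
  have e2 : 0 < e / 2 by rewrite divr_gt0.
  exists (orbit_ball K (e / 2) x,
    [set j | (K `<=` j.1)%fset /\ 0 < j.2 <= e / 2]).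
    split; first exact: orbit_ball_nbhs.
    by exists (K, e / 2).
  move=> [x' [L f]] [/= xx' [KL /andP[f0 fe]]]; exists A => // y x'y.
  apply: KA => g gK.
  have h1 := xx' g gK; have h2 := orbit_ballW KL fe x'y gK.
  by have := theta_tri (alpha g x) (alpha g x') (alpha g y); lra.
move=> -[[K e] /= e0 H].
exists K, e; split=> // x; apply: (H (K, e)) => //=.
by rewrite e0 lexx.
Qed.
End Generated.

(** * Separated and spanning sets *)

Section DistLp.
Context (R : realType) (Gamma : groupType) (X : topologicalType).
Variables (alpha : Gamma -> X -> X) (theta : X -> X -> R).
Hypothesis theta_ge0 : forall x y, 0 <= theta x y.
Implicit Types (F : {fset Gamma}) (p : \bar R) (x y : X).

(** The normalization by [|F|] to the power [1 / p] gives a constant function its own value as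
    norm. *)
Lemma dist_lp_le F p x y (c : R) : (1%:E <= p)%E -> F != fset0 -> 0 <= c ->
  (forall g, g \in F -> theta (alpha g x) (alpha g y) <= c) ->
  dist_lp alpha theta F p x y <= c.
Proof.
move=> p1 F0 c0 thc; have n0 : 0 < #|` F|%:R :> R by rewrite ltr0n cardfs_gt0.
case: p p1 => [r| |] //=; last first.
  by move=> _; rewrite big_seq; elim/big_ind: _ => // a b ac bc; rewrite ge_max ac.
rewrite lee_fin => r1; have r0 : 0 < r by exact: lt_le_trans r1.
rewrite ler_pdivrMr ?powR_gt0//.
have -> : c * #|` F|%:R `^ r^-1 = (c `^ r * #|` F|%:R) `^ r^-1.
  by rewrite powRM ?powR_ge0// -powRrM mulfV ?gt_eqF// powRr1.
apply: ge0_ler_powR; rewrite ?nnegrE ?invr_ge0 ?(ltW r0)//.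
- by apply: sumr_ge0 => g _; exact: powR_ge0.
- by rewrite mulr_ge0// powR_ge0.
rewrite mulr_natr -(iter_addr_0 _ (c `^ r)) -count_predT -big_const_seq.
rewrite big_seq [leRHS]big_seq; apply: ler_sum => g gF.
by apply: ge0_ler_powR; rewrite ?nnegrE ?(ltW r0)// thc.
Qed.

(** For finite [p = r], Markov's inequality for [r]-th powers bounds the proportion by
    [(e / t) ^ r], hence by [e / t] since [e <= t] and [1 <= r]. For the maximum no place is far. *)
Lemma card_far_le F p x y (e t : R) : (1%:E <= p)%E -> 0 < e <= t ->
  dist_lp alpha theta F p x y <= e ->
  #|` [fset g in F | (t < theta (alpha g x) (alpha g y))%R]%fset|%:R
    <= e / t * #|` F|%:R :> R.
Proof.
move=> p1 /andP[e0 et] dxy; have t0 : 0 < t by exact: lt_le_trans et.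
have [F0|F0] := eqVneq F fset0.
  suff -> : [fset g in F | (t < theta (alpha g x) (alpha g y))%R]%fset = fset0.
    by rewrite cardfs0 mulr_ge0// divr_ge0// ltW.
  by rewrite F0; apply/fsetP => g; rewrite !inE.
have n0 : 0 < #|` F|%:R :> R by rewrite ltr0n cardfs_gt0.
case: p p1 dxy => [r| |] //=; last first.
  move=> _ dxy.
  suff -> : [fset g in F | (t < theta (alpha g x) (alpha g y))%R]%fset = fset0.
    by rewrite cardfs0 mulr_ge0// divr_ge0// ltW.
  apply/fsetP => g; rewrite !inE/=; apply/negP => /andP[gF].
  apply/negP; rewrite -leNgt; apply: le_trans et; apply: le_trans dxy.
  have : forall s : seq Gamma, g \in s -> theta (alpha g x) (alpha g y) <=
      \big[Num.max/0]_(h <- s) theta (alpha h x) (alpha h y).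
    elim=> // h s IH; rewrite big_cons in_cons le_max => /orP[/eqP ->|/IH ->].
      by rewrite lexx.
    by rewrite orbT.
  exact.
rewrite lee_fin => r1; have r0 : 0 < r by exact: lt_le_trans r1.
rewrite ler_pdivrMr ?powR_gt0// => dxy.
set S := \sum_(g <- F) _ in dxy.
have S0 : 0 <= S by apply: sumr_ge0 => g _; exact: powR_ge0.
have Sle : S <= e `^ r * #|` F|%:R.
  have : (S `^ r^-1) `^ r <= (e * #|` F|%:R `^ r^-1) `^ r.
    by apply: ge0_ler_powR; rewrite ?nnegrE ?powR_ge0 ?(ltW r0)// mulr_ge0
      ?powR_ge0// ltW.
  by rewrite powRM ?powR_ge0 ?(ltW e0)// -!powRrM mulVf ?gt_eqF// !powRr1// ltW.
set B := [fset g in F | _]%fset.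
have Bge : t `^ r * #|` B|%:R <= S.
  rewrite mulr_natr -(iter_addr_0 _ (t `^ r)) -count_predT -big_const_seq.
  apply: (@le_trans _ _ (\sum_(g <- B) theta (alpha g x) (alpha g y) `^ r)).
    rewrite big_seq [leRHS]big_seq; apply: ler_sum => g.
    rewrite !inE/= => /andP[gF tg].
    by apply: ge0_ler_powR; rewrite ?nnegrE ?(ltW r0)// ltW.
  rewrite /S big_fset/= big_mkcond/=; apply: ler_sum => g _.
  by case: ifP => // _; exact: powR_ge0.
have tr0 : 0 < t `^ r by exact: powR_gt0.
rewrite -(ler_pM2l tr0); apply: le_trans Bge _; apply: le_trans Sle _.
rewrite mulrA ler_wpM2r//.
have -> : e `^ r = (e / t) `^ r * t `^ r.
  by rewrite -powRM ?divr_ge0 ?(ltW e0) ?(ltW t0)// mulfVK// gt_eqF.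
rewrite mulrC ler_wpM2l ?(ltW tr0)//.
by apply: ge1r_powR => //; rewrite divr_gt0// ler_pdivrMr// mul1r.
Qed.

End DistLp.

(** Each [u] gets the weight [t] to the number of its changes, which is at least [t ^ k] for at most
    [k] changes because [t <= 1]. The total weight factors over [I], with factors at most
    [1 + t * |A|]. *)
Lemma card_few_changes (R : realType) (I A : finType) (w : {ffun I -> A})
    (t k : R) : 0 < t <= 1 ->
  #|[pred u : {ffun I -> A} | #|[pred i | u i != w i]|%:R <= k]|%:R * t `^ k
    <= (1 + t * #|A|%:R) ^+ #|I|.
Proof.
move=> /andP[t0 t1].
pose c (i : I) (a : A) : R := if a == w i then 1 else t.
have c0 i a : 0 <= c i a by rewrite /c; case: ifP => // _; exact: ltW.
have prodE (u : {ffun I -> A}) :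
    \prod_i c i (u i) = t ^+ #|[pred i | u i != w i]|.
  rewrite -prodr_const [RHS]big_mkcond/=; apply: eq_bigr => i _.
  by rewrite /c inE; case: ifP.
apply: (@le_trans _ _ (\sum_(u : {ffun I -> A}) \prod_i c i (u i))).
  rewrite mulr_natl -sumr_const big_mkcond/=; apply: ler_sum => u _.
  case: ifP => [|_]; last exact: prodr_ge0.
  by rewrite inE prodE => uk; rewrite -powR_mulrn ?(ltW t0)// ger_powR ?t0.
rewrite -(bigA_distr_bigA c) -prodr_const.
apply: ler_prod => i _; rewrite sumr_ge0//=.
rewrite (bigD1 (w i))//= {1}/c eqxx lerD2l.
apply: (@le_trans _ _ (\sum_(a : A) t)).
  rewrite [leLHS]big_mkcond/=; apply: ler_sum => a _.
  by rewrite /c; case: eqP => //= _; exact: ltW.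
by rewrite sumr_const mulr_natr.
Qed.

(** * Separated and spanning numbers against cover numbers *)

Section SeparatedSpanning.
Context (R : realType) (Gamma : groupType) (X : topologicalType).
Variables (alpha : Gamma -> X -> X) (theta : X -> X -> R).
Hypothesis theta_ge0 : forall x y, 0 <= theta x y.
Hypothesis theta_refl : forall x, theta x x = 0.
Hypothesis theta_sym : forall x y, theta x y = theta y x.
Variable p : \bar R.
Hypothesis p1 : (1%:E <= p)%E.
Implicit Types (F : {fset Gamma}) (x y : X).

Lemma dist_lp_sym F x y :
  dist_lp alpha theta F p x y = dist_lp alpha theta F p y x.
Proof.
by rewrite /dist_lp; case: p => [r| |];
  under eq_bigr do rewrite theta_sym.
Qed.

(** Two points in one member of the join stay within [e] along [F], so a separated set has at most
    one point in each member. *)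
Lemma sep_number_le_cover F (e : R) (U : set (set X)) :
  0 <= e -> F != fset0 ->
  (forall A, U A -> forall x y, A x -> A y -> theta x y <= e) ->
  (sep_number alpha theta F p e <= cover_number R (cover_join alpha U F))%E.
Proof.
move=> e0 F0 Usmall; apply: ge_ereal_sup => _ [E Esep <-].
apply: le_ereal_inf_tmp => _ [V [VU Vc] <-]; rewrite lee_fin ler_nat.
have /choice[f fP] : forall x, exists A, [set` V] A /\ A x.
  by move=> x; have : setT x by []; rewrite -Vc => -[A VA Ax]; exists A.
have f_inj : {in E &, injective f}.
  move=> x y xE yE fxy; apply: contrapT => xy.
  have := Esep x y xE yE xy; apply/negP; rewrite -leNgt.
  have [Vx fx] := fP x; have [_ fy] := fP y; rewrite -fxy in fy.
  apply: dist_lp_le => // g gF.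
  have [u uU ufx] := VU _ Vx; rewrite -ufx in fx fy.
  exact: (Usmall _ (uU _ gF)) (fx g gF) (fy g gF).
rewrite -(card_in_imfset imfset_key f_inj)/=.
by apply/fsubset_leq_card/fsubsetP => _ /imfsetP[x _ ->]; have [] := fP x.
Qed.

(** A separated set of maximal cardinality is spanning, as a point far from all of it could be
    added; finiteness of the supremum provides such a set. *)
Lemma span_number_le_sep F (e : R) : 0 <= e -> F != fset0 ->
  (sep_number alpha theta F p e < +oo)%E ->
  (span_number alpha theta F p e <= sep_number alpha theta F p e)%E.
Proof.
move=> e0 F0 sfin.
pose P n := `[< exists E : {fset X},
  separated_set alpha theta F p e [set` E] /\ #|` E| = n >].
have ex : exists n, P n by exists 0%N; apply/asboolP; exists fset0.
have le_s n : P n -> (n%:R%:E <= sep_number alpha theta F p e)%E.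
  by move=> /asboolP[E [Esep <-]]; apply: ereal_sup_ubound; exists E.
have sfin' : sep_number alpha theta F p e \is a fin_num.
  rewrite ge0_fin_numE//; have [n Pn] := ex.
  by apply: le_trans (le_s _ Pn); rewrite lee_fin.
have ub n : P n -> (n <= Num.truncn (fine (sep_number alpha theta F p e)))%N.
  move=> /le_s; rewrite -[X in (_ <= X)%E]fineK// lee_fin => h.
  by rewrite Num.Theory.truncn_ge_nat// (le_trans _ h).
case: (ex_maxnP ex ub) => n Pn nmax.
apply: le_trans (le_s _ Pn); move: Pn => /asboolP[E [Esep En]].
rewrite -En; apply: ereal_inf_lbound; exists E => // x.
apply: contrapT => xfar.
have far y : y \in E -> e < dist_lp alpha theta F p x y.
  by move=> yE; rewrite ltNge; apply/negP => xy; apply: xfar; exists y.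
have xE : x \notin E.
  apply/negP => /far; apply/negP; rewrite -leNgt; apply: dist_lp_le => // g _.
  by rewrite theta_refl.
have : P n.+1.
  apply/asboolP; exists (x |` E)%fset; split; last by rewrite cardfsU1 xE En.
  move=> y z /=; rewrite !in_fset1U => /orP[/eqP ->|yE] /orP[/eqP ->|zE] yz.
  - by [].
  - exact: far.
  - by rewrite dist_lp_sym; exact: far.
  - exact: Esep.
by move=> /nmax; rewrite ltnn.
Qed.

Hypothesis alpha1 : forall x, alpha 1%g x = x.
Hypothesis theta_tri : forall x y z, theta x z <= theta x y + theta y z.
Hypothesis theta_cont : continuous (fun z : X * X => theta z.1 z.2).
Hypothesis alpha_cont : forall g, continuous (alpha g).

Lemma small_generated_cover (e : R) : compact [set: X] -> 0 < e ->
  exists U, [/\ finite_open_cover U, generated_cover alpha theta U &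
    forall A, U A -> forall x y, A x -> A y -> theta x y <= e].
Proof.
move=> cX e0; have e2 : 0 < e / 2 by rewrite divr_gt0.
(* The action of the unit is kept in the formula to match the balls of [ball_generated]. *)
pose f x := [set y | theta (alpha 1%g x) (alpha 1%g y) < e / 2].
have fopen x : open (f x) by exact: (theta_ball_open theta_cont alpha_cont).
have [D Dc] : exists D : {fset X}, forall x, exists2 y, y \in D & f y x.
  pose FD : set_system {fset X} := filter_from setT
    (fun D => [set D' | (D `<=` D')%fset]).
  have FF : Filter FD.
    apply: filter_from_filter; first by exists fset0.
    move=> D D' _ _; exists (D `|` D')%fset => // D'' /=.
    by rewrite fsubUset => /andP.
  have /compact_near_coveringP/(_ _ FD
    (fun D x => exists2 y, y \in D & f y x) FF) := cX.
  case=> [x _|D _ DP].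
    exists (f x, [set D | [fset x]%fset `<=` D]%fset).
      split; last by exists [fset x]%fset.
      by apply: open_nbhs_nbhs; split; [exact: fopen|rewrite /f /= theta_refl].
    by move=> [y D] [/= xy]; rewrite fsub1set => xD; exists x.
  by exists D => x; exact: (DP D (fsubset_refl D) x I).
exists (f @` [set` D]); split.
- split; first exact/finite_image/finite_fset.
    by move=> _ [x _ <-].
  rewrite /set_cover -subTset => x _; have [y yD yx] := Dc x.
  by exists (f y) => //; exists y.
- by move=> _ [x _ <-]; exact: ball_generated.
move=> _ [c _ <-] x y; rewrite /f /= !alpha1 => cx cy.
by have := theta_tri x c y; rewrite (theta_sym x c); lra.
Qed.

(* A point of [E] and, at all but [k] elements of [F], the Lebesgue sets
   around its orbit determine a member of the join containing [x], up to the
   choice of a member of [W] at the at most [k] remaining elements. *)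
Lemma join_number_le_few_changes F (W : {fset (set X)}) (E : {fset X})
    (b : X -> set X) (t k : R) : 0 < t <= 1 ->
  set_cover [set` W] -> (forall x, b x \in W) ->
  (forall x, exists2 y, y \in E &
    #|` [fset g in F | ~~ `[< b (alpha g y) (alpha g x) >] ]%fset|%:R <= k :> R) ->
  (cover_number R (cover_join alpha [set` W] F) <=
    (#|` E|%:R * ((1 + t * #|` W|%:R) ^+ #|` F| / t `^ k))%:E)%E.
Proof.
move=> t01 Wc bW Espan; have /andP[t0 t1] := t01.
pose w y : {ffun F -> W} := [ffun g => [` bW (alpha (val g) y)]%fset].
pose Q y := [pred u : {ffun F -> W} | #|[pred i | u i != w y i]|%:R <= k].
pose m (u : {ffun F -> W}) : set X :=
  [set x | forall g, val (u g) (alpha (val g) x)].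
pose s := flatten [seq [seq m u | u <- enum (Q y)] | y <- enum_fset E].
apply: (@le_trans _ _ (size s)%:R%:E).
  apply: cover_number_le => [x|A].
    have [y yE yx] := Espan x.
    have /choice[v vP] : forall g, exists A : W, val A (alpha g x).
      move=> g; have : setT (alpha g x) by [].
      by rewrite -Wc => -[A AW Ax]; exists [` AW]%fset.
    (* Follows the Lebesgue sets along the orbit of [y] and switches to a member containing the
       orbit of [x] only where they miss it. *)
    pose u : {ffun F -> W} := [ffun g =>
      if `[< b (alpha (val g) y) (alpha (val g) x) >] then w y g
      else v (val g)].
    exists (m u).
      apply/flatten_mapP; exists y => //; apply: map_f.
      rewrite mem_enum inE; apply: le_trans yx; rewrite ler_nat.
      rewrite cardE -(size_map val).
      apply: uniq_leq_size.
        by rewrite map_inj_uniq ?enum_uniq//; exact: val_inj.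
      move=> g /mapP[h]; rewrite mem_enum !inE/= ffunE => uh ->.
      rewrite (valP h)/=; apply: contra uh => ->; exact: eqxx.
    move=> g; rewrite ffunE; case: asboolP => [|_]; last exact: vP.
    by rewrite ffunE.
  move=> /flatten_mapP[y _ /mapP[u _ ->]].
  exists (m u) => //.
  (* The value outside [F] is an arbitrary default, since the join only reads the choice on [F]. *)
  exists (fun g => if insub g is Some h then val (u h) else b (alpha g y)).
    by move=> g gF; rewrite insubT/=; exact: valP.
  apply/seteqP; split=> [x xu g|x xm g /= gF].
    by have := xu (val g) (valP g); rewrite /= valK.
  by rewrite insubT/=; exact: xm.
rewrite lee_fin size_flatten /shape -map_comp sumnE big_map natr_sum.
set B := (_ / _).
rewrite (mulrC _ B) mulr_natr -(iter_addr_0 _ B) -count_predT -big_const_seq /B.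
apply: ler_sum => y _ /=; rewrite size_map -cardE.
rewrite ler_pdivlMr ?powR_gt0//.
have := card_few_changes (w y) k t01.
by rewrite -!cardfE.
Qed.
End SeparatedSpanning.

(** * Comparison of the growth rates *)

Lemma ereal_dense (R : realType) (x y : \bar R) : (x < y)%E ->
  exists r : R, (x < r%:E)%E /\ (r%:E < y)%E.
Proof.
case: x y => [x| |] [y| |] //=.
- rewrite lte_fin => xy; exists ((x + y) / 2); rewrite !lte_fin; lra.
- by move=> _; exists (x + 1); rewrite lte_fin ltrDl ltr01 ltry.
- by move=> _; exists (y - 1); rewrite lte_fin gtrDl oppr_lt0 ltr01 ltNyr.
- by move=> _; exists 0; rewrite ltNyr ltry.
Qed.

(** Real lower bounds suffice even for infinite [h]: when [h] is [-oo] there are none, and the upper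
    bound alone forces the value. *)
Lemma cvg_at_right_of_bounds (R : realType) (f : R -> \bar R) (h : \bar R) :
  (forall e, 0 < e -> (f e <= h)%E) ->
  (forall a : R, (a%:E < h)%E ->
     exists2 e0 : R, 0 < e0 & forall e, 0 < e <= e0 -> (a%:E <= f e)%E) ->
  f e @[e --> (0 : R)^'+] --> h.
Proof.
move=> fh fa.
have near_h : \forall e \near (0 : R)^'+, (f e <= h)%E.
  by near=> e; apply: fh; near: e; exact: nbhs_right_gt.
have near_a a : (a%:E < h)%E -> \forall e \near (0 : R)^'+, (a%:E <= f e)%E.
  move=> /fa[e0 e00 H]; near=> e; apply: H; apply/andP; split.
    by near: e; exact: nbhs_right_gt.
  by near: e; exact: nbhs_right_le.
case: h fh fa near_h near_a => [h| |] _ _ near_h near_a.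
- have h1 : ((h - 1)%:E < h%:E)%E by rewrite lte_fin gtrDl oppr_lt0 ltr01.
  have near_fin : \forall e \near (0 : R)^'+, f e \is a fin_num.
    near=> e; rewrite fin_numElt; apply/andP; split.
      apply: (@lt_le_trans _ _ (h - 1)%:E); first exact: ltNyr.
      by near: e; exact: near_a.
    apply: (@le_lt_trans _ _ h%:E); last exact: ltry.
    by near: e.
  apply: cvg_EFin => //; apply/cvgrPdist_le => eps eps0; near=> e.
  have fe : f e \is a fin_num by near: e.
  have fle : (f e <= h%:E)%E by near: e.
  have fge : ((h - eps)%:E <= f e)%E.
    by near: e; apply: near_a; rewrite lte_fin gtrDl oppr_lt0.
  rewrite -(fineK fe) lee_fin in fle; rewrite -(fineK fe) lee_fin in fge.
  by rewrite /= ger0_norm ?subr_ge0//; lra.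
- by apply/cvgeyPge => a; apply: near_a; exact: ltry.
- apply: cvg_near_cst; near=> e; apply/eqP; rewrite -leeNy_eq.
  by near: e.
Unshelve. all: by end_near. Qed.

Section Sandwich.
Context (R : realType) (Gamma : groupType) (X : topologicalType).
Variables (alpha : Gamma -> X -> X) (theta : X -> X -> R).
Hypothesis alpha1 : forall x, alpha 1%g x = x.
Hypothesis alphaM : forall g h x, alpha (g * h)%g x = alpha g (alpha h x).
Hypothesis alpha_cont : forall g, continuous (alpha g).
Hypothesis theta_ge0 : forall x y, 0 <= theta x y.
Hypothesis theta_refl : forall x, theta x x = 0.
Hypothesis theta_sym : forall x y, theta x y = theta y x.
Hypothesis theta_tri : forall x y z, theta x z <= theta x y + theta y z.
Hypothesis theta_cont : continuous (fun z : X * X => theta z.1 z.2).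
Hypothesis X_compact : compact [set: X].
Variables (p : \bar R) (p1 : (1%:E <= p)%E).
Context (d : Order.disp_t) (J : preorderType d).
Variable F : J -> {fset Gamma}.
Hypothesis F_Folner : left_Folner_net R F.

Local Notation S n e := (normalized_log (F n) (sep_number alpha theta (F n) p e)).
Local Notation Q n e := (normalized_log (F n) (span_number alpha theta (F n) p e)).
Local Notation N U n := (normalized_log (F n)
  (cover_number R (cover_join alpha U (F n)))).

Let Jdir : directed J. Proof. by case: F_Folner. Qed.
Let F0 n : F n != fset0. Proof. by case: F_Folner. Qed.

Lemma sep_number_ge0 A e : (0 <= sep_number alpha theta A p e)%E.
Proof.
by apply: ereal_sup_ubound; exists fset0; rewrite ?cardfs0.
Qed.

Lemma span_number_ge0 A e : (0 <= span_number alpha theta A p e)%E.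
Proof. by apply: le_ereal_inf_tmp => _ [E _ <-]; rewrite lee_fin. Qed.

(** Half of [kappa] pays for the factor [(1 + t * m) ^+ |F n|] in the number of choices, the other
    half for the division by [t] to the power [k = eta * |F n|]. *)
Lemma cover_entropy_le_span (U : set (set X)) (kappa : R) :
  finite_set U -> set_cover U -> generated_cover alpha theta U -> 0 < kappa ->
  exists2 e0 : R, 0 < e0 & forall e, 0 < e <= e0 ->
    \forall n \near net_filter J, (N U n <= Q n e + kappa%:E)%E.
Proof.
move=> Ufin Ucov Ugen k0; have PF := net_filter_proper Jdir.
have [X0|/set0P[x0 _]] := eqVneq [set: X] set0.
  exists 1 => // e _; near=> n.
  by rewrite cover_number_empty// normalized_log0// leNye.
have [W UW] := finite_fsetP.1 Ufin.
pose m : R := #|` W|%:R.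
have m0 : 0 <= m by [].
pose t := Num.min 1 (kappa / (2 * (m + 1))).
have t0 : 0 < t by rewrite lt_min ltr01 divr_gt0// mulr_gt0// ltr_wpDl.
have t01 : 0 < t <= 1 by rewrite t0 ge_min lexx.
have tm : t * m <= kappa / 2.
  have : t * (2 * (m + 1)) <= kappa.
    by rewrite -ler_pdivlMr ?mulr_gt0 ?ltr_wpDl// ge_min lexx orbT.
  nra.
pose eta := kappa / (2 * (`|ln t| + 1)).
have eta0 : 0 < eta by rewrite divr_gt0// mulr_gt0// ltr_wpDl.
have etat : - (eta * ln t) <= kappa / 2.
  have : eta * (2 * (`|ln t| + 1)) = kappa.
    by rewrite mulfVK// gt_eqF// mulr_gt0// ltr_wpDl.
  have : eta * - ln t <= eta * `|ln t|.
    by apply: ler_wpM2l; [exact: ltW|rewrite -normrN ler_norm].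
  lra.
have [K [del [del0 Kdel]]] := Lebesgue_number theta_refl theta_sym theta_tri
  theta_cont alpha_cont X_compact Ucov Ugen.
pose c : R := #|` K|%:R.
have c0 : 0 <= c by [].
pose t1 := del / 2.
have t10 : 0 < t1 by rewrite divr_gt0.
pose r := eta / (2 * (c + 1)).
have r0 : 0 < r by rewrite divr_gt0// mulr_gt0// ltr_wpDl.
have cr : c * (r + r) <= eta.
  have -> : eta = r * (2 * (c + 1)).
    by rewrite mulfVK// gt_eqF// mulr_gt0// ltr_wpDl.
  lra.
(* The bound [t1] is required by [card_far_le]; the bound [t1 * r] makes the proportion of far
   places at most [r]. *)
exists (Num.min t1 (t1 * r)); first by rewrite lt_min t10 mulr_gt0.
move=> e /andP[e0]; rewrite le_min => /andP[et1 etr].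
have := Folner_almost_invariant Jdir K F_Folner r0.
apply: filterS => n Finv.
have n0 : 0 < #|` F n|%:R :> R by rewrite ltr0n cardfs_gt0.
have /choice[b bP] : forall x, exists A, U A /\ orbit_ball alpha theta K del x `<=` A.
  by move=> x; have [A UA xA] := Kdel x; exists A.
pose k := eta * #|` F n|%:R.
pose G := (1 + t * m) ^+ #|` F n| / t `^ k.
have tm1 : 0 < 1 + t * m by rewrite ltr_pwDl// mulr_ge0// ltW.
have G0 : 0 < G by rewrite divr_gt0 ?exprn_gt0 ?powR_gt0.
have bad_le x y : dist_lp alpha theta (F n) p x y <= e ->
    #|` [fset g in F n | ~~ `[< b (alpha g y) (alpha g x) >]]%fset|%:R <= k.
  move=> dxy; pose B0 := [fset g in F n |
    (t1 < theta (alpha g x) (alpha g y))%R]%fset.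
  have B0le : #|` B0|%:R <= r * #|` F n|%:R.
    apply: le_trans (card_far_le theta_ge0 p1 _ dxy) _; first by rewrite e0.
    by rewrite ler_wpM2r// ler_pdivrMr// mulrC.
  (* At an exceptional [g] some [h] in [K] has its orbit points at [h * g] at distance at least
     [del]: either [h * g] leaves [F n], rare by invariance, or it is a far place, rare by
     Markov. *)
  have sub : ([fset g in F n | ~~ `[< b (alpha g y) (alpha g x) >]] `<=`
      fset_prod (fset_inv K) ((fset_prod K (F n) `\` F n) `|` B0))%fset.
    apply/fsubsetP => g; rewrite !inE/= => /andP[gF /asboolPn nb].
    have : exists2 h, h \in K & del <= theta (alpha (h * g)%g x) (alpha (h * g)%g y).
      apply: contrapT => no; apply: nb; apply: (bP (alpha g y)).2 => h hK.
      rewrite -!alphaM theta_sym ltNge; apply/negP => le.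
      by apply: no; exists h.
    move=> [h hK hg]; rewrite -(mulKg h g); apply: mem_fset_prod.
      exact: mem_fset_inv.
    rewrite in_fsetU in_fsetD mem_fset_prod// andbT !inE/=.
    have [_|//] := boolP ((h * g)%g \in F n); rewrite /=.
    by apply: lt_le_trans hg; rewrite /t1; lra.
  apply: (@le_trans _ _ (c * (#|` fset_prod K (F n) `\` F n|%fset%:R + #|` B0|%:R))).
    rewrite -natrD -natrM ler_nat; apply: leq_trans (fsubset_leq_card sub) _.
    apply: leq_trans (card_fset_prod _ _) _.
    by apply: leq_mul; [exact: leq_imfset_card|exact: leq_card_fsetU].
  apply: (@le_trans _ _ (c * ((r + r) * #|` F n|%:R))).
    by apply: ler_wpM2l => //; rewrite mulrDl; exact: lerD.
  by rewrite mulrA ler_wpM2r.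
have [kN NE] := joinN_fin R alpha UW Ucov (F n).
have kN1 : 1 <= kN%:R :> R.
  by have := cover_number_ge1 R (cover_join alpha U (F n)) x0; rewrite NE lee_fin.
have span_ge : ((kN%:R / G)%:E <= span_number alpha theta (F n) p e)%E.
  apply: le_ereal_inf_tmp => _ [E Espan <-]; rewrite lee_fin ler_pdivrMr//.
  have := @join_number_le_few_changes R Gamma X alpha (F n) W E b t k t01.
  rewrite -UW NE lee_fin; apply=> //.
    by move=> x; have := (bP x).1; rewrite UW.
  move=> x; have [y yE xy] := Espan x; exists y => //; exact: bad_le.
have kN0 : 0 < kN%:R :> R by exact: lt_le_trans kN1.
have kG : 0 < kN%:R / G by exact: divr_gt0.
apply: (@le_trans _ _ ((normalized_log (F n) (kN%:R / G)%:E + kappa%:E)%E)).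
  rewrite NE !normalized_log_EFin// -EFinD lee_fin.
  rewrite ln_div ?posrE// mulrBl -addrA lerDl.
  rewrite addrC subr_ge0 ler_pdivrMr//.
  rewrite ln_div ?posrE ?exprn_gt0 ?powR_gt0// lnXn// ln_powR -(mulr_natr (ln _)).
  have lt : ln (1 + t * m) <= kappa / 2.
    apply: le_trans tm; apply: le_ln1Dx.
    by apply: lt_le_trans (ltrN10 _) _; rewrite mulr_ge0// ltW.
  have -> : ln (1 + t * m) * #|` F n|%:R - k * ln t =
      (ln (1 + t * m) - eta * ln t) * #|` F n|%:R by rewrite /k; ring.
  by rewrite ler_wpM2r//; lra.
by rewrite leeD2r// le_normalized_log// lee_fin ltW.
Unshelve. all: by end_near. Qed.

Lemma limsup_sep_le (U : set (set X)) (e : R) : 0 <= e ->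
  finite_set U -> set_cover U ->
  (forall A, U A -> forall x y, A x -> A y -> theta x y <= e) ->
  (net_limsup (fun n => S n e) <= htop_cover R alpha U)%E.
Proof.
move=> e0 Ufin Ucov Usmall; have PF := net_filter_proper Jdir.
have NU := @htop_coverP R Gamma X alpha alphaM U Ufin Ucov d J F F_Folner.
(* A real strictly between the two sides eventually bounds the cover terms, hence also the upper
   limit. *)
rewrite leNgt; apply/negP => /ereal_dense[a [ha]]; apply/negP; rewrite -leNgt.
apply: net_limsup_le.
have : \forall n \near net_filter J, (N U n < a%:E)%E.
  exact: (NU _ (open_ereal_lt' ha)).
apply: filterS => n /ltW; apply: le_trans.
apply: le_normalized_log; first exact: sep_number_ge0.
exact: sep_number_le_cover.
Qed.

(** The finiteness asked for by [span_number_le_sep] comes from a finite cover by small sets. *)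
Lemma span_le_sep (e : R) n : 0 < e -> (Q n e <= S n e)%E.
Proof.
move=> e0; apply: le_normalized_log; first exact: span_number_ge0.
apply: span_number_le_sep => //; first exact: ltW.
have [U [[Ufin _ Ucov] _ Usmall]] := small_generated_cover theta_refl theta_sym
  alpha1 theta_tri theta_cont alpha_cont X_compact e0.
have [W UW] := finite_fsetP.1 Ufin.
have [k NE] := joinN_fin R alpha UW Ucov (F n).
apply: (@le_lt_trans _ _ (cover_number R (cover_join alpha U (F n)))).
  by apply: sep_number_le_cover => //; exact: ltW.
by rewrite NE ltry.
Qed.

Let h : \bar R := ereal_sup [set htop_cover R alpha U | U in
  [set U : set (set X) | finite_open_cover U /\ generated_cover alpha theta U]].

Lemma limsup_sep_le_sup (e : R) : 0 < e ->
  (net_limsup (fun n => S n e) <= h)%E.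
Proof.
move=> e0.
have [U [Uopen Ugen Usmall]] := small_generated_cover theta_refl theta_sym
  alpha1 theta_tri theta_cont alpha_cont X_compact e0.
have [Ufin _ Ucov] := Uopen.
apply: (@le_trans _ _ (htop_cover R alpha U)).
  by apply: limsup_sep_le => //; exact: ltW.
by apply: ereal_sup_ubound; exists U.
Qed.

(** A real [b] is put between [a] and the entropy of some generated cover; the gap [b - a] is the
    loss allowed in [cover_entropy_le_span]. *)
Lemma liminf_span_ge (a : R) : (a%:E < h)%E ->
  exists2 e0 : R, 0 < e0 & forall e, 0 < e <= e0 ->
    (a%:E <= net_liminf (fun n => Q n e))%E.
Proof.
move=> /ereal_sup_gt[_ [U [[Ufin _ Ucov] Ugen] <-]] /ereal_dense[b [ab hb]].
have PF := net_filter_proper Jdir.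
have NU := @htop_coverP R Gamma X alpha alphaM U Ufin Ucov d J F F_Folner.
rewrite lte_fin in ab.
have ba : 0 < b - a by rewrite subr_gt0.
have [e0 e00 He] := cover_entropy_le_span Ufin Ucov Ugen ba.
exists e0 => // e /He NQ; apply: net_liminf_ge.
have Nb : \forall n \near net_filter J, (b%:E < N U n)%E.
  exact: (NU _ (open_ereal_gt' hb)).
apply: filterS2 Nb NQ => n bN NQ.
have := le_trans (ltW bN) NQ.
by rewrite -leeBlDr// -EFinB opprB addrC subrK.
Qed.

(** All four quantities lie between the lower limit for spanning sets, which eventually exceeds any
    real below [h], and the upper limit for separated sets, which never exceeds [h]. *)
Lemma entropy_limits :
  [/\ net_limsup (fun n => S n e) @[e --> (0 : R)^'+] --> h,
      net_liminf (fun n => S n e) @[e --> (0 : R)^'+] --> h,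
      net_limsup (fun n => Q n e) @[e --> (0 : R)^'+] --> h &
      net_liminf (fun n => Q n e) @[e --> (0 : R)^'+] --> h].
Proof.
have up (f : R -> \bar R) : (forall e, 0 < e ->
    (net_liminf (fun n => Q n e) <= f e)%E /\
    (f e <= net_limsup (fun n => S n e))%E) ->
    f e @[e --> (0 : R)^'+] --> h.
  move=> fP; apply: cvg_at_right_of_bounds => [e e0|a /liminf_span_ge[e0 e00 H]].
    exact: le_trans (fP e e0).2 (limsup_sep_le_sup e0).
  exists e0 => // e ee0; apply: le_trans (H e ee0) _.
  by have /andP[/fP[]] := ee0.
have QS e : 0 < e -> forall n, (Q n e <= S n e)%E by move=> ? n; exact: span_le_sep.
split; apply: up => e e0; split.
- apply: le_trans (net_liminf_le_limsup Jdir _) _.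
  exact/le_net_limsup/QS.
- exact: lexx.
- exact/le_net_liminf/QS.
- exact: net_liminf_le_limsup.
- exact: net_liminf_le_limsup.
- exact/le_net_limsup/QS.
- exact: lexx.
- apply: le_trans (net_liminf_le_limsup Jdir _) _.
  exact/le_net_limsup/QS.
Qed.
End Sandwich.

Theorem theorem4p2 (R : realType) (Gamma : groupType) (X : topologicalType)
    (alpha : Gamma -> X -> X) (theta : X -> X -> R)
    (d : Order.disp_t) (J : preorderType d) (F : J -> {fset Gamma})
    (p : \bar R)
    (Gamma_amenable : amenable R Gamma)
    (X_compact : compact [set: X]) (X_hausdorff : hausdorff_space X)
    (alpha_action : action_by_homeos alpha)
    (theta_pseudometric : continuous_pseudometric theta)
    (F_Folner : left_Folner_net R F)
    (p_ge1 : (1%:E <= p)%E) :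
  let S n e := normalized_log (F n) (sep_number alpha theta (F n) p e) in
  let Q n e := normalized_log (F n) (span_number alpha theta (F n) p e) in
  let limits_are (h : \bar R) :=
    [/\ net_limsup (S ^~ e) @[e --> (0 : R)^'+] --> h,
        net_liminf (S ^~ e) @[e --> (0 : R)^'+] --> h,
        net_limsup (Q ^~ e) @[e --> (0 : R)^'+] --> h &
        net_liminf (Q ^~ e) @[e --> (0 : R)^'+] --> h] in
  limits_are (ereal_sup [set htop_cover R alpha U | U in
    [set U : set (set X) |
      finite_open_cover U /\ generated_cover alpha theta U]])
  /\ (topology_generated alpha theta -> limits_are (htop R alpha)).
Proof.
have [alpha1 alphaM alpha_homeo] := alpha_action.
have alpha_cont g : continuous (alpha g) by have [] := alpha_homeo g.
have [theta_ge0 theta_refl theta_sym theta_tri theta_cont] := theta_pseudometric.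
move=> S Q limits_are.
have limits := entropy_limits alpha1 alphaM alpha_cont theta_ge0 theta_refl
  theta_sym theta_tri theta_cont X_compact p_ge1 F_Folner.
split=> // top_gen; rewrite /htop.
(* When [theta] generates the topology every open cover is generated, so both suprema run over the
   same covers. *)
suff -> : finite_open_cover (X := X) = [set U : set (set X) |
    finite_open_cover U /\ generated_cover alpha theta U] by [].
apply/seteqP; split=> [U Uopen|U []//]; split=> // A UA.
by have [_ oU _] := Uopen; apply/top_gen/oU.
Qed.
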